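(* Consider the bilinear saddle point problem $\min_{x\in\mathbb{R}^{d_x}}\max_{y\in\mathbb{R}^{d_y}}p(x)+x^TBy-q(y)$, where $p:\mathbb{R}^{d_x}\to\mathbb{R}$ is $L_p$-smooth and $\mu_p$-strongly convex, $q:\mathbb{R}^{d_y}\to\mathbb{R}$ is $L_q$-smooth and $\mu_q$-strongly convex ($\mu_p,\mu_q>0$), and $B\in\mathbb{R}^{d_x\times d_y}$ is a matrix with $\lambda_{\max}(BB^T)>0$ and $\lambda_{\min}(BB^T)\ge0$. Then Algorithm 1 (described in the context, with its auxiliary subproblems solved by a suitable iterative method using multiplications by $B$ and $B^T$) finds an $\varepsilon$-solution of this problem using $$\mathcal{O}\left(\max\left\{1,\sqrt{\frac{L_p}{\mu_p}},\sqrt{\frac{L_q}{\mu_q}}\right\}\log\frac1\varepsilon\right)\quad\text{calls of }\nabla p(x),\nabla q(y)$$ and $$\mathcal{O}\left(\min\{K_1,K_2\}\,\log\frac{\sqrt{\lambda_{\max}(BB^T)}}{\min\{\mu_p,\mu_q\}}\,\log\frac1\varepsilon\right)\quad\text{calls of }B\text{ or }B^T,$$ where $$K_1=\max\left\{\sqrt{\frac{L_p\lambda_{\max}(BB^T)}{\mu_p\lambda_{\min}(BB^T)}},\sqrt{\frac{L_q\lambda_{\max}(BB^T)}{\mu_q\lambda_{\min}(BB^T)}}\right\},\qquad K_2=\max\left\{\sqrt{\frac{L_p}{\mu_p}},\sqrt{\frac{L_q}{\mu_q}},\sqrt{\frac{\lambda_{\max}(BB^T)}{\mu_p\mu_q}}\right\}$$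 (with $K_1=+\infty$ if $\lambda_{\min}(BB^T)=0$).
   Context: $\|\cdot\|$ is the Euclidean norm; $L$-smooth means the gradient is $L$-Lipschitz; $\mu$-strong convexity of differentiable $f$ means $f(y)\ge f(x)+\langle\nabla f(x),y-x\rangle+\frac{\mu}{2}\|x-y\|^2$. $\lambda_{\max}$, $\lambda_{\min}$ denote largest and smallest eigenvalues. A call of $B$ or $B^T$ is a multiplication of a vector by that matrix. A pair $(\hat x,\hat y)$ is an $\varepsilon$-solution if $\|\hat x-x^*\|^2+\|\hat y-y^*\|^2\le\varepsilon$, where $(x^*,y^* )$ is the solution (saddle point). In $\mathcal{O}(\cdot)$ the factor $\log\frac1\varepsilon$ stands for the logarithm of $C/\varepsilon$, where $C$ depends on the starting point and problem parameters but not on $\varepsilon$. Algorithm 1 is applied to the equivalent problem $\min_x\max_y\tilde p(x)+R(x,y)-\tilde q(y)$ with $\tilde p(x)=p(x)-\frac{\mu_p}{2}\|x\|^2$, $\tilde q(y)=q(y)-\frac{\mu_q}{2}\|y\|^2$, $R(x,y)=\frac{\mu_p}{2}\|x\|^2+x^TBy-\frac{\mu_q}{2}\|y\|^2$. Algorithm 1. Input: $x^0=x_f^0$, $y^0=y_f^0$; parameters $\alpha,\eta_x,\eta_y$. For $k=0,1,\dots,K-1$: (1) $x_g^k=\alpha x^k+(1-\alpha)x_f^k$, $\;y_g^k=\alpha y^k+(1-\alpha)y_f^k$; (2) compute an approximate solution $(\hat x^{k+1},\hat y^{k+1})$ of $\min_x\max_yA_\eta^k(x,y)$, where $$A_\eta^k(x,y)=\langle\nabla\tilde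 p(x_g^k),x\rangle+\tfrac{1}{2\eta_x}\|x-x^k\|^2+R(x,y)-\langle\nabla\tilde q(y_g^k),y\rangle-\tfrac{1}{2\eta_y}\|y-y^k\|^2,$$ accurate enough that $\eta_x\|\nabla_x A_\eta^k(\hat x^{k+1},\hat y^{k+1})\|^2+\eta_y\|\nabla_y A_\eta^k(\hat x^{k+1},\hat y^{k+1})\|^2\le \frac{1}{6\eta_x}\|\hat x^{k+1}-x^k\|^2+\frac{1}{6\eta_y}\|\hat y^{k+1}-y^k\|^2$; (3) $x^{k+1}=x^k-\eta_x\left(\nabla\tilde p(x_g^k)+\nabla_xR(\hat x^{k+1},\hat y^{k+1})\right)$, $\;y^{k+1}=y^k-\eta_y\left(\nabla\tilde q(y_g^k)-\nabla_yR(\hat x^{k+1},\hat y^{k+1})\right)$; (4) $x_f^{k+1}=x_g^k+\alpha(\hat x^{k+1}-x^k)$, $\;y_f^{k+1}=y_g^k+\alpha(\hat y^{k+1}-y^k)$. Output: $x^K,y^K$. Parameters: if $\frac{L_p}{\mu_p}\ge\frac{L_q}{\mu_q}$, then $\alpha=\min\{1,\sqrt{\mu_p/L_p}\}$, $\eta_x=\min\{\frac{1}{3\mu_p},\frac{1}{3L_p\alpha}\}$, $\eta_y=\frac{\mu_p}{\mu_q}\eta_x$; otherwise $\alpha=\min\{1,\sqrt{\mu_q/L_q}\}$, $\eta_y=\min\{\frac{1}{3\mu_q},\frac{1}{3L_q\alpha}\}$, $\eta_x=\frac{\mu_q}{\mu_p}\eta_y$.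
   Formalization: Both logarithmic factors are read as max{1, log(·)}: literally the bound on calls of B or B^T is zero or negative when √λ_max(BB^T) ≤ min{μ_p,μ_q} (and both bounds are when ε ≥ C), which is false since every iteration makes such calls. *)

(* Defs.v *)
From HB Require Import structures.
From mathcomp Require Import all_boot all_order all_algebra.
From mathcomp Require Import all_classical all_reals all_analysis.

Set Implicit Arguments.
Unset Strict Implicit.
Unset Printing Implicit Defensive.

Import Order.TTheory GRing.Theory Num.Theory.
Import numFieldNormedType.Exports.

Local Open Scope classical_set_scope.
Local Open Scope ring_scope.

Section Euclidean.
Variables (R : realType) (n : nat).
Implicit Types (u v : 'cV[R]_n) (f : 'cV[R]_n -> R) (A : 'M[R]_n).

(* The library norm `|u| on matrices is the max norm, hence these. *)
Definition dot u v : R := \sum_(i < n) u i ord0 * v i ord0.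
Definition sqnorm u : R := dot u u.
Definition enorm u : R := Num.sqrt (sqnorm u).

Definition grad f u : 'cV[R]_n := \col_i 'd f u (delta_mx i ord0).

Definition smooth (L : R) f : Prop :=
  (forall u, differentiable f u) /\
  (forall u v, enorm (grad f u - grad f v) <= L * enorm (u - v)).

Definition strongly_convex (mu : R) f : Prop :=
  (forall u, differentiable f u) /\
  (forall u v, f u + dot (grad f u) (v - u) + mu / 2 * sqnorm (u - v) <= f v).

(* Only used for symmetric A with n > 0: the set of eigenvalues is then finite
   and nonempty, so that sup and inf are its maximum and minimum. *)
Definition lambda_max A : R := sup [set a | eigenvalue A a].
Definition lambda_min A : R := inf [set a | eigenvalue A a].

End Euclidean.

Record params (R : realType) := Params {
  Lp : R; Lq : R; mup : R; muq : R;
  lmax : R;  (* lambda_max (B B^T) *)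
  lmin : R   (* lambda_min (B B^T) *)
}.

Section StepSizes.
Variables (R : realType) (P : params R).

Definition p_dominates : bool := Lq P / muq P <= Lp P / mup P.

Definition alpha : R :=
  if p_dominates then Num.min 1 (Num.sqrt (mup P / Lp P))
  else Num.min 1 (Num.sqrt (muq P / Lq P)).

Definition eta_x_dom : R := Num.min (1 / (3 * mup P)) (1 / (3 * Lp P * alpha)).
Definition eta_y_dom : R := Num.min (1 / (3 * muq P)) (1 / (3 * Lq P * alpha)).

Definition eta_x : R :=
  if p_dominates then eta_x_dom else muq P / mup P * eta_y_dom.
Definition eta_y : R :=
  if p_dominates then mup P / muq P * eta_x_dom else eta_y_dom.

End StepSizes.

Section Problem.
Variables (R : realType) (dx dy : nat).
Variables (p : 'cV[R]_dx -> R) (q : 'cV[R]_dy -> R) (B : 'M[R]_(dx, dy)).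

Definition objective (x : 'cV[R]_dx) (y : 'cV[R]_dy) : R :=
  p x + dot x (B *m y) - q y.

Definition saddle_point (xs : 'cV[R]_dx) (ys : 'cV[R]_dy) : Prop :=
  forall x y, objective xs y <= objective xs ys <= objective x ys.

Definition eps_solution (eps : R) (x : 'cV[R]_dx) (y : 'cV[R]_dy) : Prop :=
  exists xs ys, saddle_point xs ys /\ sqnorm (x - xs) + sqnorm (y - ys) <= eps.

End Problem.

Record state (R : realType) (dx dy : nat) := State {
  st_x : 'cV[R]_dx; st_y : 'cV[R]_dy; st_xf : 'cV[R]_dx; st_yf : 'cV[R]_dy
}.

Section Algorithm.
Variables (R : realType) (dx dy : nat).
Variables (p : 'cV[R]_dx -> R) (q : 'cV[R]_dy -> R) (B : 'M[R]_(dx, dy)).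
Variable P : params R.
Implicit Types (x : 'cV[R]_dx) (y : 'cV[R]_dy) (s : state R dx dy).

Definition p_tilde x : R := p x - mup P / 2 * sqnorm x.
Definition q_tilde y : R := q y - muq P / 2 * sqnorm y.
Definition coupling x y : R :=
  mup P / 2 * sqnorm x + dot x (B *m y) - muq P / 2 * sqnorm y.

Definition xg s : 'cV[R]_dx := alpha P *: st_x s + (1 - alpha P) *: st_xf s.
Definition yg s : 'cV[R]_dy := alpha P *: st_y s + (1 - alpha P) *: st_yf s.

Definition subproblem s x y : R :=
  dot (grad p_tilde (xg s)) x + 1 / (2 * eta_x P) * sqnorm (x - st_x s)
  + coupling x y
  - dot (grad q_tilde (yg s)) y - 1 / (2 * eta_y P) * sqnorm (y - st_y s).

Definition accurate s xh yh : Prop :=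
  eta_x P * sqnorm (grad (fun x => subproblem s x yh) xh)
  + eta_y P * sqnorm (grad (fun y => subproblem s xh y) yh)
  <= 1 / (6 * eta_x P) * sqnorm (xh - st_x s)
     + 1 / (6 * eta_y P) * sqnorm (yh - st_y s).

Definition iteration s s' : Prop :=
  exists xh yh,
    accurate s xh yh /\
    s' = State
      (st_x s - eta_x P *: (grad p_tilde (xg s)
                            + grad (fun x => coupling x yh) xh))
      (st_y s - eta_y P *: (grad q_tilde (yg s)
                            - grad (fun y => coupling xh y) yh))
      (xg s + alpha P *: (xh - st_x s))
      (yg s + alpha P *: (yh - st_y s)).

End Algorithm.

(* Deterministic adaptive procedures that see p, q and B only through answers
   to queries: the gradients of p and q, and products with B and B^T. *)
Inductive oracle_prog (R : realType) (dx dy : nat) (T : Type) : Type :=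
| Ret of T
| CallGradP of 'cV[R]_dx & ('cV[R]_dx -> oracle_prog R dx dy T)
| CallGradQ of 'cV[R]_dy & ('cV[R]_dy -> oracle_prog R dx dy T)
| CallB of 'cV[R]_dy & ('cV[R]_dx -> oracle_prog R dx dy T)
| CallBT of 'cV[R]_dx & ('cV[R]_dy -> oracle_prog R dx dy T).
Arguments Ret {R dx dy T} _.
Arguments CallGradP {R dx dy T} _ _.
Arguments CallGradQ {R dx dy T} _ _.
Arguments CallB {R dx dy T} _ _.
Arguments CallBT {R dx dy T} _ _.

Section Oracle.
Variables (R : realType) (dx dy : nat).
Local Notation prog := (oracle_prog R dx dy).

Fixpoint bind T U (m : prog T) (f : T -> prog U) : prog U :=
  match m with
  | Ret a => f a
  | CallGradP x k => CallGradP x (fun g => bind (k g) f)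
  | CallGradQ y k => CallGradQ y (fun g => bind (k g) f)
  | CallB y k => CallB y (fun v => bind (k v) f)
  | CallBT x k => CallBT x (fun v => bind (k v) f)
  end.

Fixpoint products_only T (m : prog T) : Prop :=
  match m with
  | Ret _ => True
  | CallGradP _ _ | CallGradQ _ _ => False
  | CallB _ k => forall v, products_only (k v)
  | CallBT _ k => forall v, products_only (k v)
  end.

Variables (p : 'cV[R]_dx -> R) (q : 'cV[R]_dy -> R) (B : 'M[R]_(dx, dy)).

Fixpoint result T (m : prog T) : T :=
  match m with
  | Ret a => a
  | CallGradP x k => result (k (grad p x))
  | CallGradQ y k => result (k (grad q y))
  | CallB y k => result (k (B *m y))
  | CallBT x k => result (k (B^T *m x))
  end.

Fixpoint grad_calls T (m : prog T) : nat :=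
  match m with
  | Ret _ => 0%N
  | CallGradP x k => (grad_calls (k (grad p x))).+1
  | CallGradQ y k => (grad_calls (k (grad q y))).+1
  | CallB y k => grad_calls (k (B *m y))
  | CallBT x k => grad_calls (k (B^T *m x))
  end.

Fixpoint product_calls T (m : prog T) : nat :=
  match m with
  | Ret _ => 0%N
  | CallGradP x k => product_calls (k (grad p x))
  | CallGradQ y k => product_calls (k (grad q y))
  | CallB y k => (product_calls (k (B *m y))).+1
  | CallBT x k => (product_calls (k (B^T *m x))).+1
  end.

End Oracle.

(* A subproblem solver is given the parameters, the prox centre (x^k, y^k) and
   the gradients of p_tilde at x_g^k and of q_tilde at y_g^k, which determine
   the subproblem up to B. *)
Definition inner_solver (R : realType) : Type :=
  forall dx dy : nat, params R ->
    'cV[R]_dx -> 'cV[R]_dy -> 'cV[R]_dx -> 'cV[R]_dy ->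
    oracle_prog R dx dy ('cV[R]_dx * 'cV[R]_dy).

Section Implementation.
Variables (R : realType) (solve : inner_solver R) (dx dy : nat) (P : params R).
Local Notation prog := (oracle_prog R dx dy).

Definition iteration_prog (s : state R dx dy) : prog (state R dx dy) :=
  CallGradP (xg P s) (fun gp =>
  CallGradQ (yg P s) (fun gq =>
  let gpt := gp - mup P *: xg P s in
  let gqt := gq - muq P *: yg P s in
  bind (solve P (st_x s) (st_y s) gpt gqt) (fun z =>
  let: (xh, yh) := z in
  CallB yh (fun Byh =>
  CallBT xh (fun BTxh =>
  Ret (State
    (st_x s - eta_x P *: (gpt + (mup P *: xh + Byh)))
    (st_y s - eta_y P *: (gqt - (BTxh - muq P *: yh)))
    (xg P s + alpha P *: (xh - st_x s))
    (yg P s + alpha P *: (yh - st_y s)))))))).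

Fixpoint algorithm (x0 : 'cV[R]_dx) (y0 : 'cV[R]_dy) (K : nat) :
    prog (state R dx dy) :=
  match K with
  | 0 => Ret (State x0 y0 x0 y0)
  | K'.+1 => bind (algorithm x0 y0 K') iteration_prog
  end.

End Implementation.

Section Complexity.
Variables (R : realType) (P : params R).

(* Logarithmic factors inside O(.) are read as at least 1: ln t is nonpositive
   for t <= 1, where it cannot bound a number of calls. *)
Definition log_factor (t : R) : R := Num.max 1 (ln t).

Definition grad_rate : R :=
  Num.max 1 (Num.max (Num.sqrt (Lp P / mup P)) (Num.sqrt (Lq P / muq P))).

(* Meaningful only for lmin P != 0, since division by 0 yields 0; rate_B below
   treats lmin P = 0 as K1 = +oo. *)
Definition K1 : R :=
  Num.max (Num.sqrt (Lp P * lmax P / (mup P * lmin P)))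
          (Num.sqrt (Lq P * lmax P / (muq P * lmin P))).

Definition K2 : R :=
  Num.max (Num.sqrt (Lp P / mup P))
    (Num.max (Num.sqrt (Lq P / muq P))
             (Num.sqrt (lmax P / (mup P * muq P)))).

Definition rate_B : R := if lmin P == 0 then K2 else Num.min K1 K2.

Definition product_rate : R :=
  rate_B * log_factor (Num.sqrt (lmax P) / Num.min (mup P) (muq P)).

End Complexity.

(* Main.v *)
(** Outer loop.  Let [W] be the squared distance of [(x, y)] to the saddle point,
    weighted by [1 / eta_x] and [1 / eta_y], and let [D] be the Bregman distance
    of [(x_f, y_f)] for the shifted functions [p_tilde] and [q_tilde].  As
    [mup * eta_x = muq * eta_y = alpha / 3], the potential
    [(1 + alpha / 3) W + (2 / alpha) D] contracts by [1 - alpha / 4] at each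
    iteration, and [alpha^-1] is exactly the gradient rate, so that
    [(4 / alpha) ln (C / eps)] iterations suffice.

    Inner solver.  Maximizing the subproblem exactly in [y] leaves a quadratic in
    [x] with Hessian [H = cx + B B^T / cy], where [cx = mup + 1 / eta_x] and
    [cy = muq + 1 / eta_y].  Nesterov's method for the bounds
    [cx + lmin / cy <= H <= cx + lmax / cy] needs about
    [sqrt ((cx cy + lmax) / (cx cy + lmin))] steps per digit.  Since
    [cx cy >= 9 mup muq / alpha^2], this root is at most both
    [sqrt (lmax / lmin)] and [1 + alpha sqrt (lmax / (mup muq))] up to a constant,
    so a single method attains [min (K1, K2)].  The stopping criterion only asks
    for a relative accuracy polynomial in [1 + lmax / (mup muq)]. *)

Require Import Defs.
From mathcomp Require Import all_boot all_order all_algebra.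
From mathcomp Require Import all_classical all_reals all_analysis.
From mathcomp Require Import ring lra.
Import Order.TTheory GRing.Theory Num.Theory.
Import numFieldNormedType.Exports.
Local Open Scope ring_scope.

Set Implicit Arguments.
Unset Strict Implicit.
Unset Printing Implicit Defensive.

(** * Euclidean geometry *)

Section DotProduct.
Variable R : realType.
Implicit Types n : nat.

Lemma dotC n (u v : 'cV[R]_n) : dot u v = dot v u.
Proof. by apply: eq_bigr => i _; rewrite mulrC. Qed.

Lemma dotDl n (u v w : 'cV[R]_n) : dot (u + v) w = dot u w + dot v w.
Proof. by rewrite /dot -big_split; apply: eq_bigr => i _; rewrite mxE mulrDl. Qed.

Lemma dotZl n a (u v : 'cV[R]_n) : dot (a *: u) v = a * dot u v.
Proof. by rewrite /dot mulr_sumr; apply: eq_bigr => i _; rewrite mxE mulrA. Qed.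

Lemma dotNl n (u v : 'cV[R]_n) : dot (- u) v = - dot u v.
Proof. by rewrite -scaleN1r dotZl mulN1r. Qed.

Lemma dotDr n (u v w : 'cV[R]_n) : dot w (u + v) = dot w u + dot w v.
Proof. by rewrite dotC dotDl !(dotC w). Qed.

Lemma dotZr n a (u v : 'cV[R]_n) : dot u (a *: v) = a * dot u v.
Proof. by rewrite dotC dotZl dotC. Qed.

Lemma dotNr n (u v : 'cV[R]_n) : dot u (- v) = - dot u v.
Proof. by rewrite dotC dotNl dotC. Qed.

Lemma dot0l n (u : 'cV[R]_n) : dot 0 u = 0.
Proof. by rewrite -(scale0r u) dotZl mul0r. Qed.

Definition dotE := (dotDl, dotDr, dotNl, dotNr, dotZl, dotZr).

Lemma sqnorm_ge0 n (u : 'cV[R]_n) : 0 <= sqnorm u.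
Proof. by apply: sumr_ge0 => i _; rewrite -expr2 sqr_ge0. Qed.

Lemma sqnorm_eq0 n (u : 'cV[R]_n) : (sqnorm u == 0) = (u == 0).
Proof.
apply/eqP/eqP => [u0|->]; last by rewrite /sqnorm dot0l.
apply/colP => i; rewrite mxE; apply/eqP.
have /psumr_eq0P : forall i : 'I_n, true -> 0 <= u i ord0 * u i ord0.
  by move=> j _; rewrite -expr2 sqr_ge0.
by move=> /(_ u0 i isT) => e; rewrite -(orbb (u i ord0 == 0)) -mulf_eq0 e.
Qed.

Lemma sqnorm_gt0 n (u : 'cV[R]_n) : (0 < sqnorm u) = (u != 0).
Proof. by rewrite lt0r sqnorm_ge0 sqnorm_eq0 andbT. Qed.

Lemma sqnormZ n a (u : 'cV[R]_n) : sqnorm (a *: u) = a ^+ 2 * sqnorm u.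
Proof. by rewrite /sqnorm !dotE; ring. Qed.

Lemma sqnormN n (u : 'cV[R]_n) : sqnorm (- u) = sqnorm u.
Proof. by rewrite /sqnorm !dotE; ring. Qed.

Lemma sqnormB_sym n (u v : 'cV[R]_n) : sqnorm (u - v) = sqnorm (v - u).
Proof. by rewrite -sqnormN opprB. Qed.

Lemma sqnormD_le n (u v : 'cV[R]_n) :
  sqnorm (u + v) <= 2 * sqnorm u + 2 * sqnorm v.
Proof.
have := sqnorm_ge0 (u - v); rewrite /sqnorm !dotE (dotC v u); lra.
Qed.

Lemma dot_mulmx m n (A : 'M[R]_(m, n)) (u : 'cV[R]_n) (v : 'cV[R]_m) :
  dot (A *m u) v = dot u (A^T *m v).
Proof.
have e k (a b : 'cV[R]_k) : dot a b = (a^T *m b) ord0 ord0.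
  by rewrite mxE; apply: eq_bigr => i _; rewrite mxE.
by rewrite !e trmx_mul mulmxA.
Qed.

(** The form of [G] is nonnegative on all combinations of [u] and [v], so its discriminant on them
    is nonpositive. Besides the identity, [G] will be a shifted matrix or a Hessian, with [v] equal
    to [G *m u]. *)
Lemma psd_cauchy_schwarz n (G : 'M[R]_n) (u v : 'cV[R]_n) :
  G^T = G -> (forall w, 0 <= dot (G *m w) w) ->
  dot (G *m u) v ^+ 2 <= dot (G *m u) u * dot (G *m v) v.
Proof.
move=> GT Gpos; have e : dot (G *m v) u = dot (G *m u) v by rewrite dot_mulmx GT dotC.
have key s t : 0 <= s ^+ 2 * dot (G *m u) u + 2 * s * t * dot (G *m u) v
                 + t ^+ 2 * dot (G *m v) v.
  have := Gpos (s *: u + t *: v); rewrite mulmxDr -!scalemxAr !dotE e; lra.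
have a0 := Gpos u; have c0 := Gpos v.
move: (key) (key) a0 c0; set a := dot _ u; set b := dot _ v; set c := dot (G *m v) v.
(* The first two choices give [a * c - b ^+ 2] times [c] and times [a]; the third one forces [b = 0]
   when [a = c = 0]. *)
move=> /(_ c (- b)) k1 /(_ (- b) a) k2 a0 c0; have := key 1 (- b).
rewrite -/a -/b -/c => k3.
have [cp|cn] := ltrP 0 c; first by rewrite -subr_ge0 -(pmulr_rge0 _ cp); lra.
have [ap|an] := ltrP 0 a; first by rewrite -subr_ge0 -(pmulr_rge0 _ ap); lra.
have c00 : c = 0 by lra.
have a00 : a = 0 by lra.
by move: k3; rewrite c00 a00; lra.
Qed.

Lemma cauchy_schwarz n (u v : 'cV[R]_n) : dot u v ^+ 2 <= sqnorm u * sqnorm v.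
Proof.
have := @psd_cauchy_schwarz _ 1%:M u v; rewrite !mul1mx; apply.
  by rewrite trmx1.
by move=> w; rewrite mul1mx sqnorm_ge0.
Qed.

Lemma mulmx_bounded m n (A : 'M[R]_(m, n)) :
  exists2 C, 0 < C & forall u, sqnorm (A *m u) <= C * sqnorm u.
Proof.
(* The squared Frobenius norm, plus 1 for positivity. *)
exists (1 + \sum_i sqnorm (row i A)^T).
  by rewrite ltr_pwDl // sumr_ge0 // => i _; rewrite sqnorm_ge0.
move=> u; rewrite mulrDl mul1r ler_wpDl ?sqnorm_ge0 // mulr_suml.
apply: ler_sum => i _; rewrite -expr2; apply: le_trans (cauchy_schwarz _ _).
rewrite le_eqVlt; apply/orP; left; apply/eqP; congr (_ ^+ 2).
by rewrite mxE; apply: eq_bigr => j _; rewrite !mxE.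
Qed.

End DotProduct.

(** * Rayleigh quotients *)

Section Rayleigh.
Variable R : realType.
Implicit Types n : nat.

Lemma dot_mulmx_le n (A : 'M[R]_n) :
  exists2 C, 0 < C & forall v, `|dot (A *m v) v| <= C * sqnorm v.
Proof.
have [C C0 CP] := mulmx_bounded A; exists (1 + C); first lra.
move=> v; have := CP v; have v0 := sqnorm_ge0 v.
(* The two signs bound twice the absolute value of [dot (A *m v) v] by
   [sqnorm (A *m v) + sqnorm v]. *)
have := sqnorm_ge0 (A *m v - v); have := sqnorm_ge0 (A *m v + v).
rewrite /sqnorm !dotE (dotC v) -!/(sqnorm _) ler_norml => h1 h2 h3.
have : 0 <= C * sqnorm v by rewrite mulr_ge0 // ltW.
by move=> h4; apply/andP; split; lra.
Qed.

(** [eigenvalue] speaks of row vectors; by symmetry, transposition passes to column vectors. *)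
Lemma eigenvalue_sym n (A : 'M[R]_n) a : A^T = A ->
  (exists2 v : 'cV[R]_n, v != 0 & A *m v = a *: v) <-> eigenvalue A a.
Proof.
move=> AT; split => [[v v0 Av]|/eigenvalueP [v vA v0]].
  apply/eigenvalueP; exists v^T; last by rewrite trmx_eq0.
  by rewrite -{1}AT -trmx_mul Av linearZ.
exists v^T; first by rewrite trmx_eq0.
by rewrite -{1}AT -trmx_mul vA linearZ.
Qed.

(* The infimum m of the Rayleigh quotient is an eigenvalue: otherwise A - m is
   invertible, and |(A - m) v|^2 <= C <(A - m) v, v> keeps the quotient away
   from m. *)
Lemma rayleigh_min n (A : 'M[R]_n) : (0 < n)%N -> A^T = A ->
  exists2 a, eigenvalue A a & forall v, a * sqnorm v <= dot (A *m v) v.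
Proof.
move=> n0 AT; pose S := [set dot (A *m v) v | v in [set v | sqnorm v = 1]]%classic.
have [C C0 CP] := dot_mulmx_le A.
have [v0 v01] : exists v : 'cV[R]_n, sqnorm v = 1.
  exists (delta_mx (Ordinal n0) 0); rewrite /sqnorm /dot (bigD1 (Ordinal n0)) //=.
  rewrite big1 ?mxE ?eqxx ?mulr1 ?addr0 // => i /negbTE i0.
  by rewrite !mxE i0 mul0r.
have Slb : has_lbound S.
  exists (- C) => _ [v /= v1 <-]; have := CP v; rewrite v1 mulr1 ler_norml.
  by case/andP.
have Sinf : has_inf S by split => //; exists (dot (A *m v0) v0); exists v0.
set m := inf S.
have mP v : m * sqnorm v <= dot (A *m v) v.
  have [->|vn0] := eqVneq v 0; first by rewrite mulmx0 /sqnorm !dot0l mulr0.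
  have vp : 0 < sqnorm v by rewrite sqnorm_gt0.
  have : m <= dot (A *m ((Num.sqrt (sqnorm v))^-1 *: v)) ((Num.sqrt (sqnorm v))^-1 *: v).
    apply: ge_inf => //; exists ((Num.sqrt (sqnorm v))^-1 *: v) => //=.
    by rewrite sqnormZ exprVn sqr_sqrtr ?sqnorm_ge0 // mulVf // gt_eqF.
  rewrite -scalemxAr !dotE mulrA -expr2 exprVn sqr_sqrtr ?sqnorm_ge0 //.
  by rewrite ler_pdivlMl // mulrC.
exists m => //; apply/(eigenvalue_sym _ AT).
pose G := A - m%:M.
have GT : G^T = G by rewrite linearB /= AT tr_scalar_mx.
have GE v : G *m v = A *m v - m *: v by rewrite mulmxBl mul_scalar_mx.
have Gpos v : 0 <= dot (G *m v) v.
  by rewrite GE !dotE -/(sqnorm v); have := mP v; lra.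
have [Gu|Gu] := boolP (G \in unitmx); last first.
  move: Gu; rewrite unitmxE unitfE negbK => /det0P [v vn0 vG]; exists v^T.
    by rewrite trmx_eq0.
  apply/eqP; rewrite -subr_eq0 -GE -GT -trmx_mul vG trmx0; exact: eqxx.
exfalso; have [D D0 DP] := mulmx_bounded (invmx G).
have [F F0 FP] := dot_mulmx_le G.
have GG v : sqnorm (G *m v) <= F * dot (G *m v) v.
  have [e|gn0] := eqVneq (G *m v) 0.
    by rewrite e /sqnorm !dot0l mulr0.
  have gp : 0 < sqnorm (G *m v) by rewrite sqnorm_gt0.
  have := psd_cauchy_schwarz v (G *m v) GT Gpos; rewrite -/(sqnorm (G *m v)).
  have := FP (G *m v); rewrite ler_norml => /andP [_ h1] h2.
  rewrite -(ler_pM2r gp) -expr2 (le_trans h2) // mulrC mulrAC ler_wpM2r //.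
have : exists2 x, S x & x < m + (D * F)^-1.
  by apply: inf_adherent => //; rewrite invr_gt0 mulr_gt0.
move=> [_ [v /= v1 <-]]; apply/negP; rewrite -leNgt.
have := DP (G *m v); rewrite mulKmx // v1 => h1.
have : (D * F)^-1 <= dot (G *m v) v.
  rewrite -div1r ler_pdivrMr ?mulr_gt0 // (le_trans h1) //.
  by rewrite mulrCA ler_wpM2l ?(ltW D0) // [_ * F]mulrC; exact: GG.
by rewrite GE !dotE -/(sqnorm v) v1; lra.
Qed.

Lemma rayleigh_max n (A : 'M[R]_n) : (0 < n)%N -> A^T = A ->
  exists2 a, eigenvalue A a & forall v, dot (A *m v) v <= a * sqnorm v.
Proof.
move=> n0 AT; have NAT : (- A)^T = - A by rewrite linearN /= AT.
have [a /(eigenvalue_sym _ NAT) [v v0 vE] aP] := rayleigh_min n0 NAT; exists (- a).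
  apply/(eigenvalue_sym _ AT); exists v => //.
  by rewrite scaleNr -vE mulNmx opprK.
by move=> w; have := aP w; rewrite mulNmx !dotE; lra.
Qed.

Lemma eigenvalue_rayleigh n (A : 'M[R]_n) a b : A^T = A ->
  (forall v, a * sqnorm v <= dot (A *m v) v <= b * sqnorm v) ->
  forall c, eigenvalue A c -> a <= c <= b.
Proof.
move=> AT abP c /(eigenvalue_sym _ AT) [v v0 vE]; have := abP v.
by rewrite vE !dotE -/(sqnorm v) !ler_pM2r ?sqnorm_gt0.
Qed.

(** The extreme Rayleigh quotients are eigenvalues and enclose all the others, so the set under
    [sup] and [inf] is bounded and contains them. *)
Lemma lambda_rayleigh n (A : 'M[R]_n) : (0 < n)%N -> A^T = A ->
  forall v, lambda_min A * sqnorm v <= dot (A *m v) v <= lambda_max A * sqnorm v.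
Proof.
move=> n0 AT v; have [a ea aP] := rayleigh_min n0 AT.
have [b eb bP] := rayleigh_max n0 AT.
have abP w : a * sqnorm w <= dot (A *m w) w <= b * sqnorm w by rewrite aP bP.
have cP := eigenvalue_rayleigh AT abP.
apply/andP; split.
  apply: le_trans (aP v); rewrite ler_wpM2r ?sqnorm_ge0 //; apply: ge_inf => //.
  by exists a => c /cP /andP [].
apply: le_trans (bP v) _; rewrite ler_wpM2r ?sqnorm_ge0 //; apply: ub_le_sup => //.
by exists b => c /cP /andP [].
Qed.

(** The zero matrix has no eigenvalue but 0, and none at all in dimension 0, where [sup] takes its
    default value 0. *)
Lemma lambda_max_neq0 n (A : 'M[R]_n) : 0 < lambda_max A -> A != 0.
Proof.
apply: contraTneq => ->; rewrite -leNgt /lambda_max; set S := (X in sup X).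
have [[a Sa]|/set0P/negP/negPn/eqP ->] := pselect (S !=set0)%classic; last by rewrite sup0.
apply: ge_sup; first by exists a.
move=> b /eigenvalueP [v vE v0]; move: vE; rewrite mulmx0 => /esym/eqP.
by rewrite scaler_eq0 (negbTE v0) orbF => /eqP ->.
Qed.

End Rayleigh.

(** * Gradients of quadratic perturbations *)

Section Gradients.
Local Open Scope classical_set_scope.
Variable R : realType.
Implicit Types n : nat.

Lemma differentiable_quadratic n (a b : R) (c x : 'cV[R]_n) :
  differentiable (fun u => a * sqnorm u + dot c u + b) x.
Proof.
have dcoord i : differentiable (fun u : 'cV[R]_n => u i ord0 : R) x.
  exact: differentiable_coord.
have -> : (fun u => a * sqnorm u + dot c u + b) =
    \sum_(i < n) (fun u : 'cV[R]_n => (a * u i ord0 + c i ord0) * u i ord0) + cst b.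
  apply/funext => u; rewrite /= fctE fct_sumE /cst /sqnorm /dot mulr_sumr -big_split.
  by congr (_ + _); apply: eq_bigr => i _ /=; ring.
apply: differentiableD => //; apply: differentiable_sum => i.
apply: (@differentiableM _ _ (fun u : 'cV[R]_n => a * u i ord0 + c i ord0)
  (fun u => u i ord0)) => //.
apply: (@differentiableD _ _ _ (fun u : 'cV[R]_n => a * u i ord0) (cst (c i ord0))) => //.
exact: (@differentiableM _ _ (cst a) (fun u : 'cV[R]_n => u i ord0)).
Qed.

Lemma diff_quadratic n (a b : R) (c x v : 'cV[R]_n) :
  'd (fun u => a * sqnorm u + dot c u + b) x v = dot (2 * a *: x + c) v.
Proof.
rewrite -deriveE; last exact: differentiable_quadratic.
rewrite /derive; apply: cvg_lim => //=.
(* The difference quotient of a quadratic is exactly this affine function of [h]. *)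
have : (fun h : R => dot (2 * a *: x + c) v + h * (a * sqnorm v)) @ 0^'
         --> dot (2 * a *: x + c) v + 0 * (a * sqnorm v).
  apply: cvgD; first exact: cvg_cst.
  by apply: cvgM; [exact: nbhs_dnbhs | exact: cvg_cst].
rewrite mul0r addr0; apply: cvg_trans; apply: near_eq_cvg; near=> h.
have h0 : h != 0 by near: h; exact: nbhs_dnbhs_neq.
rewrite /sqnorm /= !dotE (dotC v x) -[_ *: _]/(_ * _); field.
Unshelve. all: by end_near.
Qed.

Lemma dot_delta n (g : 'cV[R]_n) i : dot g (delta_mx i ord0) = g i ord0.
Proof.
rewrite /dot (bigD1 i) //= big1 ?mxE ?eqxx ?mulr1 ?addr0 // => j /negbTE ji.
by rewrite !mxE ji mulr0.
Qed.

Lemma grad_add_quadratic n (f : 'cV[R]_n -> R) (a b : R) (c x : 'cV[R]_n) :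
  differentiable f x ->
  grad (fun u => f u + (a * sqnorm u + dot c u + b)) x
  = grad f x + (2 * a *: x + c).
Proof.
move=> df; apply/colP => i; rewrite [LHS]mxE [RHS]mxE [grad f x _ _]mxE.
rewrite (@diffD _ _ _ f) //; last exact: differentiable_quadratic.
by rewrite /= diff_quadratic dot_delta.
Qed.

Lemma grad_quadratic n (a b : R) (c x : 'cV[R]_n) :
  grad (fun u => a * sqnorm u + dot c u + b) x = 2 * a *: x + c.
Proof.
by apply/colP => i; rewrite [LHS]mxE diff_quadratic dot_delta.
Qed.

End Gradients.

(** * Outer iteration on one block of variables *)

Section SmoothStronglyConvex.
Variables (R : realType) (n : nat) (L mu : R) (f : 'cV[R]_n -> R).
Hypotheses (fL : smooth L f) (fmu : strongly_convex mu f).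
Implicit Types u v : 'cV[R]_n.

Lemma sqr_enorm u : enorm u ^+ 2 = sqnorm u.
Proof. by rewrite sqr_sqrtr ?sqnorm_ge0. Qed.

Lemma grad_lipschitz u v :
  sqnorm (grad f u - grad f v) <= L ^+ 2 * sqnorm (u - v).
Proof.
have [_ /(_ u v) h] := fL; rewrite -!sqr_enorm -exprMn.
by rewrite !expr2 ler_pM // sqrtr_ge0.
Qed.

Lemma dot_grad_le u v : dot (grad f u - grad f v) (u - v) <= L * sqnorm (u - v).
Proof.
have [_ /(_ u v) h] := fL; rewrite -sqr_enorm expr2 mulrA.
apply: le_trans (ler_wpM2r (sqrtr_ge0 _) h).
rewrite -sqrtrM ?sqnorm_ge0 // (le_trans (ler_norm _)) // -sqrtr_sqr.
by rewrite ler_wsqrtr ?cauchy_schwarz.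
Qed.

Lemma dot_grad_ge u v : mu * sqnorm (u - v) <= dot (grad f u - grad f v) (u - v).
Proof.
have [_ h] := fmu; have := h u v; have := h v u.
rewrite (sqnormB_sym v u) -(opprB u v).
move: (f u) (f v) (grad f u) (grad f v) => ? ? ? ?; rewrite !dotE; lra.
Qed.

(** Both constants are compared on one unit vector. In dimension 0 there is none, and any [mu] and
    [L] are admissible. *)
Lemma strong_convexity_le_smoothness : (0 < n)%N -> mu <= L.
Proof.
move=> n0; pose u := delta_mx (Ordinal n0) ord0 : 'cV[R]_n.
have u0 : 0 < sqnorm (u - 0).
  rewrite subr0 sqnorm_gt0; apply/negP => /eqP/colP/(_ (Ordinal n0)).
  by rewrite !mxE !eqxx => /eqP; rewrite oner_eq0.
by rewrite -(ler_pM2r u0) (le_trans (dot_grad_ge _ _)) ?dot_grad_le.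
Qed.

(** Strong convexity of [f] is plain convexity of [f] minus [mu / 2] times the squared norm, whose
    gradient is [grad f v - mu *: v]. *)
Lemma shifted_lower u v :
  f v - mu / 2 * sqnorm v + dot (grad f v - mu *: v) (u - v)
  <= f u - mu / 2 * sqnorm u.
Proof.
have [_ h] := fmu; have := h v u.
move: (f u) (f v) (grad f v) => ? ? ?; rewrite /sqnorm !dotE (dotC u v); lra.
Qed.

(* The constant 2L instead of L spares the integral form of the descent lemma;
   the step sizes have enough slack to absorb it. *)
Lemma shifted_upper u v : 0 <= mu ->
  f u - mu / 2 * sqnorm u <=
  f v - mu / 2 * sqnorm v + dot (grad f v - mu *: v) (u - v) + L * sqnorm (u - v).
Proof.
move=> mu0; have [_ h] := fmu; have := h u v; have := dot_grad_le u v.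
have := mulr_ge0 mu0 (sqnorm_ge0 (u - v)).
move: (f u) (f v) (grad f u) (grad f v) => ? ? ? ?; rewrite /sqnorm !dotE (dotC u v); lra.
Qed.

End SmoothStronglyConvex.

(** * One accelerated outer step in a single block, with abstract coupling gradients [rh] and
    [rs] *)

Section OuterStep.
Variables (R : realType) (n : nat) (ft : 'cV[R]_n -> R) (gt : 'cV[R]_n -> 'cV[R]_n).
Variables (L a eta : R) (x xf xh xs rh rs : 'cV[R]_n).
Hypotheses (a0 : 0 < a) (a1 : a <= 1) (eta0 : 0 < eta).
Hypothesis lower : forall u v, ft v + dot (gt v) (u - v) <= ft u.
Hypothesis upper :
  forall u v, ft u <= ft v + dot (gt v) (u - v) + L * sqnorm (u - v).
Hypothesis stationary : gt xs + rs = 0.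

Definition bregman u := ft u - ft xs - dot (gt xs) (u - xs).

Let xg := a *: x + (1 - a) *: xf.
Let xp := x - eta *: (gt xg + rh).
Let xfp := xg + a *: (xh - x).

Lemma bregman_ge0 u : 0 <= bregman u.
Proof. by have := lower u xs; rewrite /bregman; lra. Qed.

(** Descent from [xg] to [xfp] is combined with convexity at [xf] (weight [1 - a]) and at [xs]
    (weight [a]). By the choice of [xg] and [xfp], all linear terms collapse to multiples of
    [xh - xs]. *)
Lemma accelerated_bregman_step :
  bregman xfp - (1 - a) * bregman xf - L * a ^+ 2 * sqnorm (xh - x)
  <= a * dot (gt xg - gt xs) (xh - xs).
Proof.
have u1 := upper xfp xg.
have l1 : (1 - a) * (ft xg + dot (gt xg) (xf - xg)) <= (1 - a) * ft xf.
  by rewrite ler_wpM2l ?subr_ge0.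
have l2 : a * (ft xg + dot (gt xg) (xs - xg)) <= a * ft xs.
  by rewrite ler_wpM2l ?(ltW a0).
move: u1 l1 l2; rewrite /bregman.
have -> : xfp - xg = a *: (xh - x) by rewrite /xfp addrC addKr.
rewrite sqnormZ; have -> : xfp = xg + a *: (xh - x) by [].
move: (ft _) (ft xg) (gt xg) => f1 f2 g; rewrite /xg !dotE; lra.
Qed.

(** Expanding [sqnorm (xp - xs)] yields a term in [gt xg + rh]. The Bregman step, scaled by [2 / a],
    cancels its part in [gt], which leaves only the coupling difference [rh - rs]. *)
Lemma outer_block_step :
  eta^-1 * sqnorm (xp - xs) + 2 / a * bregman xfp
  <= eta^-1 * sqnorm (x - xs) + (1 - a) * (2 / a * bregman xf)
     - 2 * dot (rh - rs) (xh - xs)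
     + eta^-1 * sqnorm (xp - xh) - eta^-1 * sqnorm (xh - x)
     + 2 * L * a * sqnorm (xh - x).
Proof.
have := accelerated_bregman_step.
rewrite -(ler_pM2l (divr_gt0 (ltr0n R 2) a0)) => key.
(* Three-point identity: the inner product is moved from [x] to the inexact point [xh]. *)
have ps : sqnorm (xp - xs) = sqnorm (x - xs)
    - 2 * eta * dot (gt xg + rh) (xh - xs) + sqnorm (xp - xh) - sqnorm (xh - x).
  rewrite /xp; move: (gt xg + rh) => g.
  rewrite /sqnorm !dotE ?(dotC xs x) ?(dotC xh x) ?(dotC g x) ?(dotC xs xh).
  by rewrite ?(dotC xs g) ?(dotC xh g); ring.
have gs : gt xs = - rs by apply/eqP; rewrite -addr_eq0 stationary.
have e1 d : 2 / a * (a * d) = 2 * d by field; exact: lt0r_neq0.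
have e2 b b' t : 2 / a * (b - (1 - a) * b' - L * a ^+ 2 * t)
    = 2 / a * b - (1 - a) * (2 / a * b') - 2 * L * a * t.
  by field; exact: lt0r_neq0.
have e3 t d t' : eta^-1 * (t - 2 * eta * d + t' - sqnorm (xh - x))
    = eta^-1 * t - 2 * d + eta^-1 * t' - eta^-1 * sqnorm (xh - x).
  by field; exact: lt0r_neq0.
have -> : dot (rh - rs) (xh - xs)
    = dot (gt xg + rh) (xh - xs) - dot (gt xg - gt xs) (xh - xs).
  by rewrite gs !dotE; ring.
move: key; rewrite e1 e2 ps e3.
move: (dot _ _) (dot _ _) => *; lra.
Qed.

End OuterStep.

(** * Nesterov acceleration for quadratics *)

Section QuadraticForm.
Variables (R : realType) (n : nat) (H : 'M[R]_n) (m M : R).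
Hypotheses (HT : H^T = H) (m0 : 0 < m).
Hypothesis mM : forall v, m * sqnorm v <= dot (H *m v) v <= M * sqnorm v.
Implicit Types u v w : 'cV[R]_n.

Lemma quadratic_form_unitmx : H \in unitmx.
Proof.
rewrite unitmxE unitfE; apply/negP => /det0P [v vn0 vH].
have /andP [h _] := mM v^T; move: h; rewrite -{1}HT -trmx_mul vH trmx0.
by rewrite dot0l leNgt mulr_gt0 // sqnorm_gt0 trmx_eq0.
Qed.

(** Cauchy-Schwarz for the form of [H], applied to [v] and [H *m v]; one factor [sqnorm (H *m v)] is
    then cancelled. *)
Lemma sqnorm_quadratic_form_le v : sqnorm (H *m v) <= M ^+ 2 * sqnorm v.
Proof.
have Hpos w : 0 <= dot (H *m w) w.
  by have /andP [h _] := mM w; apply: le_trans h; rewrite mulr_ge0 ?(ltW m0) ?sqnorm_ge0.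
have [->|g0] := eqVneq (H *m v) 0.
  by rewrite /sqnorm dot0l mulr_ge0 ?sqr_ge0 ?sqnorm_ge0.
have gp : 0 < sqnorm (H *m v) by rewrite sqnorm_gt0.
have := psd_cauchy_schwarz v (H *m v) HT Hpos; rewrite -/(sqnorm (H *m v)) => cs.
have /andP [_ h1] := mM v; have /andP [_ h2] := mM (H *m v).
rewrite -(ler_pM2r gp) -expr2 (le_trans cs) // (le_trans (ler_pM _ _ h1 h2)) //.
by rewrite le_eqVlt; apply/orP; left; apply/eqP; ring.
Qed.

Variables (th : R).
Hypotheses (th0 : 0 < th) (th1 : th <= 1) (thE : th ^+ 2 * M = m).

(** Nesterov's Lyapunov function: the suboptimality of the main iterate plus the weighted error of
    the auxiliary one. *)
Definition accel_potential (v w : 'cV[R]_n) := dot (H *m v) v / 2 + m / 2 * sqnorm w.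

(* All the vectors are errors, i.e., the minimizer is 0. *)
Lemma accel_step v w u : (1 + th) *: u = v + th *: w ->
  accel_potential (u - M^-1 *: (H *m u))
    ((1 - th) *: w + th *: (u - m^-1 *: (H *m u)))
  <= (1 - th) * accel_potential v w.
Proof.
move=> uE; have M0 : 0 < M.
  by rewrite -(pmulr_rgt0 _ (exprn_gt0 2 th0)) thE.
(* As [u] lies on the segment from [v] to [w], a single direction [d] describes both. *)
have [d wE vE] : exists2 d, w = u - d & v = u + th *: d.
  exists (u - w); first by rewrite opprB addrC subrK.
  by rewrite scalerBr addrA -[X in X + th *: u]scale1r -scalerDl uE addrK.
have eHg : dot (H *m (H *m u)) u = sqnorm (H *m u) by rewrite dot_mulmx HT.
have eHd : dot (H *m d) u = dot (H *m u) d by rewrite dot_mulmx HT dotC.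
have /andP [_ hg] := mM (H *m u); have /andP [hd _] := mM d.
have /andP [hu _] := mM u.
rewrite /accel_potential wE vE !mulmxDr !mulmxN -!scalemxAr.
move: hg hd hu eHg eHd; move: (H *m (H *m u)) (H *m d) => Hg Hd.
move: (H *m u) => g hg hd hu eHg eHd.
(* The gap of the claimed inequality is exactly the sum of [p1] to [p4]: the lower bound on [H] at
   [u], its positivity at [d], a multiple of [sqnorm d], and the upper bound on [H] at [g]. *)
have p1 : 0 <= th / 2 * (dot g u - m * sqnorm u).
  by rewrite mulr_ge0 ?subr_ge0 ?divr_ge0 ?(ltW th0).
have Hd0 : 0 <= dot Hd d by rewrite (le_trans _ hd) // mulr_ge0 ?sqnorm_ge0 ?(ltW m0).
have p2 : 0 <= th ^+ 2 * (1 - th) / 2 * dot Hd d.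
  by rewrite mulr_ge0 ?divr_ge0 ?mulr_ge0 ?exprn_ge0 ?subr_ge0 ?(ltW th0).
have p3 : 0 <= m * th * (1 - th) / 2 * sqnorm d.
  by rewrite !mulr_ge0 ?sqnorm_ge0 ?subr_ge0 ?(ltW th0) ?(ltW m0) ?invr_ge0.
have p4 : 0 <= (M^-1) ^+ 2 / 2 * (M * sqnorm g - dot Hg g).
  by rewrite mulr_ge0 ?subr_ge0 ?divr_ge0 ?exprn_ge0 ?invr_ge0 ?(ltW M0).
rewrite -subr_ge0.
apply: le_trans (addr_ge0 (addr_ge0 p1 p2) (addr_ge0 p3 p4)) _.
rewrite le_eqVlt; apply/orP; left; apply/eqP.
move: eHg eHd; rewrite /sqnorm !dotE -thE ?(dotC d u) ?(dotC u g) ?(dotC d g).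
move=> -> ->; field; rewrite !lt0r_neq0 //.
Qed.

End QuadraticForm.

(** * Call counts of oracle programs, and the accelerated method as a program *)

Section OraclePrograms.
Variables (R : realType) (dx dy : nat).
Variables (p : 'cV[R]_dx -> R) (q : 'cV[R]_dy -> R) (B : 'M[R]_(dx, dy)).
Local Notation prog := (oracle_prog R dx dy).

Lemma result_bind T U (m : prog T) (f : T -> prog U) :
  result p q B (bind m f) = result p q B (f (result p q B m)).
Proof. by elim: m => //=. Qed.

Lemma grad_calls_bind T U (m : prog T) (f : T -> prog U) :
  grad_calls p q B (bind m f)
  = (grad_calls p q B m + grad_calls p q B (f (result p q B m)))%N.
Proof. by elim: m => //= v k IH; rewrite IH. Qed.

Lemma product_calls_bind T U (m : prog T) (f : T -> prog U) :
  product_calls p q B (bind m f)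
  = (product_calls p q B m + product_calls p q B (f (result p q B m)))%N.
Proof. by elim: m => //= v k IH; rewrite IH. Qed.

Lemma products_only_bind T U (m : prog T) (f : T -> prog U) :
  products_only m -> (forall t, products_only (f t)) -> products_only (bind m f).
Proof. by move=> + fP; elim: m => //= v k IH kP w; apply: IH. Qed.

Lemma products_only_grad_calls T (m : prog T) :
  products_only m -> grad_calls p q B m = 0%N.
Proof. by elim: m => //= v k IH kP; apply: IH. Qed.

Variables (m M th : R) (G : 'cV[R]_dx -> prog 'cV[R]_dx).

Definition accel_mid (x z : 'cV[R]_dx) := (1 + th)^-1 *: (x + th *: z).

(** From the same gradient, [x] makes the short step [M^-1] and [z] averages the long step [m^-1].
    The gradient is itself a program [G], so that its products are counted. *)
Fixpoint accel_loop (k : nat) (x z : 'cV[R]_dx) : prog 'cV[R]_dx :=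
  if k is k'.+1 then
    bind (G (accel_mid x z)) (fun g =>
      accel_loop k' (accel_mid x z - M^-1 *: g)
        ((1 - th) *: z + th *: (accel_mid x z - m^-1 *: g)))
  else Ret x.

Lemma products_only_accel_loop k x z :
  (forall u, products_only (G u)) -> products_only (accel_loop k x z).
Proof.
by move=> GP; elim: k x z => //= k IH x z; apply: products_only_bind.
Qed.

Lemma product_calls_accel_loop c k x z :
  (forall u, product_calls p q B (G u) = c) ->
  product_calls p q B (accel_loop k x z) = (k * c)%N.
Proof.
move=> GP; elim: k x z => //= k IH x z.
by rewrite product_calls_bind GP IH mulSn.
Qed.

Variables (H : 'M[R]_dx) (xs : 'cV[R]_dx).
Hypotheses (HT : H^T = H) (m0 : 0 < m).
Hypothesis mM : forall v, m * sqnorm v <= dot (H *m v) v <= M * sqnorm v.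
Hypotheses (th0 : 0 < th) (th1 : th <= 1) (thE : th ^+ 2 * M = m).
Hypothesis GE : forall u, result p q B (G u) = H *m (u - xs).

Lemma accel_loop_potential k x z :
  m / 2 * sqnorm (result p q B (accel_loop k x z) - xs)
  <= (1 - th) ^+ k * accel_potential H m (x - xs) (z - xs).
Proof.
elim: k x z => /= [|k IH] x z.
  rewrite expr0 mul1r /accel_potential.
  have /andP [h _] := mM (x - xs).
  have := mulr_ge0 (ltW m0) (sqnorm_ge0 (z - xs)); lra.
rewrite result_bind GE (le_trans (IH _ _)) // exprSr -mulrA.
rewrite ler_wpM2l ?exprn_ge0 ?subr_ge0 //.
set u := accel_mid x z - xs.
have uE : (1 + th) *: u = (x - xs) + th *: (z - xs).
  rewrite /u /accel_mid scalerBr scalerA mulfV; last by rewrite lt0r_neq0 ?addr_gt0.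
  by rewrite scale1r scalerDl scale1r scalerBr opprD addrACA.
have := accel_step HT m0 mM th0 th1 thE uE.
rewrite (_ : accel_mid x z - _ - xs = u - M^-1 *: (H *m u)); last by rewrite addrAC.
rewrite (_ : _ + _ - xs = (1 - th) *: (z - xs) + th *: (u - m^-1 *: (H *m u))) //.
rewrite [_ - _ - _ in RHS]addrAC (scalerBr th _ xs) (scalerBr (1 - th) z).
rewrite addrACA -opprD -scalerDl subrK scale1r //.
Qed.

(** Both sequences start at [x], where the potential is at most [M] times the squared error because
    [m] is at most [M] on that vector. *)
Lemma accel_loop_error k x :
  m * sqnorm (result p q B (accel_loop k x x) - xs)
  <= (1 - th) ^+ k * (2 * M * sqnorm (x - xs)).
Proof.
have := accel_loop_potential k x x; set e := sqnorm (_ - _).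
have : (1 - th) ^+ k * accel_potential H m (x - xs) (x - xs)
    <= (1 - th) ^+ k * (M * sqnorm (x - xs)).
  rewrite ler_wpM2l ?exprn_ge0 ?subr_ge0 // /accel_potential.
  have /andP [h1 h2] := mM (x - xs); move: h1 h2.
  by move: (dot _ _) (sqnorm _) => ? ?; lra.
move: (sqnorm (x - xs)) => ? ?; lra.
Qed.

End OraclePrograms.

(** * The subproblem solver *)

Section SubproblemSolver.
Variable R : realType.

(** Since [1 - th <= expR (- th)], the power is at most the inverse of [(4 * Q) ^+ 3], while the
    other factor is at most [32 * Q ^+ 3]. That factor joins the loss [2 * Q] of the accelerated
    method to the precision needed in [stopping_scalar]. *)
Lemma geometric_decay (th Q : R) (k : nat) : 0 < th -> th <= 1 -> 1 <= Q ->
  3 * ln (4 * Q) / th <= k%:R ->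
  (1 - th) ^+ k * (2 * Q * (1 + 3 * Q) ^+ 2) <= 1.
Proof.
move=> th0 th1 Q1; have Q0 : 0 < 4 * Q by lra.
rewrite ler_pdivrMr // => hk.
have h1 : (1 - th) ^+ k <= ((4 * Q) ^+ 3)^-1.
  apply: (@le_trans _ _ (expR (- th) ^+ k)).
    by rewrite lerXn2r ?nnegrE ?subr_ge0 ?expR_ge0 // (le_trans _ (expR_ge1Dx _)).
  have -> : (4 * Q) ^+ 3 = expR (3 * ln (4 * Q)) by rewrite (expRM_natl 3) lnK.
  by rewrite -expRN -expRM_natl ler_expR; lra.
apply: le_trans (ler_wpM2r _ h1) _; first by rewrite !mulr_ge0 ?sqr_ge0; lra.
rewrite ler_pdivrMl ?exprn_gt0 // mulr1.
have : 0 <= (Q - 1) * Q by rewrite mulr_ge0; lra.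
have : 0 <= (Q - 1) * Q * Q by rewrite !mulr_ge0; lra.
by lra.
Qed.

Lemma sqnormB_le n (u d : 'cV[R]_n) :
  sqnorm (u - d) <= 3 * sqnorm u + 3 / 2 * sqnorm d.
Proof.
have := sqnorm_ge0 (2 *: u + d); rewrite /sqnorm !dotE (dotC d u); lra.
Qed.

(** Accuracy relative to the initial distance [r0] from the minimizer becomes accuracy relative to
    the displacement [d], which the stopping criterion uses. The constants work because
    [(1 + 3 * Q) ^+ 2 - 3 >= 9 * Q ^+ 2]. *)
Lemma stopping_scalar (Q r r0 d : R) : 1 <= Q -> 0 <= r ->
  (1 + 3 * Q) ^+ 2 * r <= r0 -> r0 <= 3 * r + 3 / 2 * d -> 6 * Q ^+ 2 * r <= d.
Proof.
move=> Q1 r_ge0 h1 h2.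
have : 0 <= (Q - 1) * r by rewrite mulr_ge0 ?subr_ge0.
lra.
Qed.

Section Solver.
Variables (dx dy : nat) (P : params R).
Local Notation prog := (oracle_prog R dx dy).

(* Unqualified, [mup] is the root multiplicity of polydiv. *)
Definition curv_x : R := Defs.mup P + (eta_x P)^-1.
Definition curv_y : R := muq P + (eta_y P)^-1.
Definition hess_min : R := curv_x + lmin P / curv_y.
Definition hess_max : R := curv_x + lmax P / curv_y.
Definition hess_rate : R := Num.sqrt (hess_min / hess_max).
(** The criterion being relative, this count depends on the parameters alone, and every outer
    iteration has the same cost. The successor makes it exceed the truncated real bound. *)
Definition inner_steps : nat :=
  (Num.truncn (3 * ln (4 * (eta_x P * hess_max)) / hess_rate)).+1.

Variables (xk : 'cV[R]_dx) (yk : 'cV[R]_dy) (gx : 'cV[R]_dx) (gy : 'cV[R]_dy).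

(** The exact maximizer of the subproblem in [y] when [v] is [B^T *m x]. *)
Definition best_y (v : 'cV[R]_dy) : 'cV[R]_dy :=
  curv_y^-1 *: (v + (eta_y P)^-1 *: yk - gy).

(** The gradient in [x] of the subproblem after maximization in [y]: by the envelope principle, the
    partial gradient at [best_y]. *)
Definition reduced_grad (x : 'cV[R]_dx) : prog 'cV[R]_dx :=
  CallBT x (fun v => CallB (best_y v) (fun w =>
    Ret (gx - (eta_x P)^-1 *: xk + curv_x *: x + w))).

Definition accel_solve : prog ('cV[R]_dx * 'cV[R]_dy) :=
  bind (accel_loop hess_min hess_max hess_rate reduced_grad inner_steps xk xk)
    (fun x => CallBT x (fun v => Ret (x, best_y v))).

Lemma products_only_accel_solve : products_only accel_solve.
Proof. by apply: products_only_bind => //; apply: products_only_accel_loop. Qed.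

Variables (p : 'cV[R]_dx -> R) (q : 'cV[R]_dy -> R) (B : 'M[R]_(dx, dy)).

Lemma product_calls_accel_solve :
  product_calls p q B accel_solve = (2 * inner_steps).+1.
Proof.
rewrite product_calls_bind (@product_calls_accel_loop _ _ _ p q B _ _ _ _ 2%N) //=.
by rewrite addn1 mulnC.
Qed.

Hypotheses (mup0 : 0 < Defs.mup P) (muq0 : 0 < muq P).
Hypotheses (ex0 : 0 < eta_x P) (ey0 : 0 < eta_y P).
Hypotheses (lmin0 : 0 <= lmin P) (lminmax : lmin P <= lmax P).
Hypothesis BP :
  forall v, lmin P * sqnorm v <= dot (B *m B^T *m v) v <= lmax P * sqnorm v.

Lemma curv_x_gt0 : 0 < curv_x.
Proof. by rewrite addr_gt0 ?invr_gt0. Qed.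

Lemma curv_y_gt0 : 0 < curv_y.
Proof. by rewrite addr_gt0 ?invr_gt0. Qed.

Lemma hess_min_gt0 : 0 < hess_min.
Proof. by rewrite ltr_pwDl ?curv_x_gt0 // divr_ge0 // ltW ?curv_y_gt0. Qed.

Lemma hess_min_le_max : hess_min <= hess_max.
Proof. by rewrite lerD2l ler_wpM2r // invr_ge0 ltW ?curv_y_gt0. Qed.

Lemma hess_max_gt0 : 0 < hess_max.
Proof. exact: lt_le_trans hess_min_gt0 hess_min_le_max. Qed.

Lemma hess_rate_gt0 : 0 < hess_rate.
Proof. by rewrite sqrtr_gt0 divr_gt0 ?hess_min_gt0 ?hess_max_gt0. Qed.

Lemma hess_rate_le1 : hess_rate <= 1.
Proof.
rewrite -(sqrtr1 R) ler_wsqrtr // ler_pdivrMr ?hess_max_gt0 // mul1r.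
exact: hess_min_le_max.
Qed.

Lemma hess_rate_sqr : hess_rate ^+ 2 * hess_max = hess_min.
Proof.
rewrite sqr_sqrtr ?divfK ?lt0r_neq0 ?hess_max_gt0 //.
by rewrite divr_ge0 ?(ltW hess_min_gt0) ?(ltW hess_max_gt0).
Qed.

Definition hess : 'M[R]_dx := curv_x%:M + curv_y^-1 *: (B *m B^T).

Lemma hess_mul (v : 'cV[R]_dx) : hess *m v = curv_x *: v + curv_y^-1 *: (B *m (B^T *m v)).
Proof. by rewrite mulmxDl mul_scalar_mx -scalemxAl mulmxA. Qed.

Lemma hess_sym : hess^T = hess.
Proof. by rewrite linearD linearZ /= tr_scalar_mx trmx_mul trmxK. Qed.

Lemma hess_bounds (v : 'cV[R]_dx) :
  hess_min * sqnorm v <= dot (hess *m v) v <= hess_max * sqnorm v.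
Proof.
have /andP [h1 h2] := BP v; rewrite hess_mul !dotE mulmxA -/(sqnorm v).
rewrite !mulrDl !lerD2l ![_ / _ * _]mulrAC ![curv_y^-1 * _]mulrC.
by rewrite !ler_wpM2r ?invr_ge0 ?(ltW curv_y_gt0).
Qed.

(** One Newton step from [xk], which is exact for a quadratic; it serves the analysis only and is
    never computed by the program. *)
Definition reduced_argmin : 'cV[R]_dx :=
  xk - invmx hess *m result p q B (reduced_grad xk).

Lemma reduced_grad_result x :
  result p q B (reduced_grad x) = hess *m (x - reduced_argmin).
Proof.
have Hu := quadratic_form_unitmx hess_sym hess_min_gt0 hess_bounds.
rewrite /reduced_argmin opprB addrCA mulmxDr mulmxA mulmxV // mul1mx.
have e u : result p q B (reduced_grad u)
    = hess *m u + (gx - (eta_x P)^-1 *: xk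
                   + B *m (curv_y^-1 *: ((eta_y P)^-1 *: yk - gy))).
  rewrite /= hess_mul /best_y -[X in curv_y^-1 *: X]addrA scalerDr mulmxDr.
  rewrite -scalemxAr; move: (B *m _) (B *m _) => w w'.
  by apply/colP => i; rewrite !mxE; ring.
rewrite !e mulmxBr; move: (hess *m _) (hess *m _) (_ + B *m _) => w w' w''.
by apply/colP => i; rewrite !mxE; ring.
Qed.

Lemma accel_solve_accurate xh yh : result p q B accel_solve = (xh, yh) ->
  B^T *m xh - muq P *: yh - gy - (eta_y P)^-1 *: (yh - yk) = 0 /\
  eta_x P * sqnorm (gx + (eta_x P)^-1 *: (xh - xk) + Defs.mup P *: xh + B *m yh)
  <= 1 / (6 * eta_x P) * sqnorm (xh - xk).
Proof.
rewrite result_bind /=; set x := result p q B (accel_loop _ _ _ _ _ _ _) => -[<- <-].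
split.
  have : curv_y *: best_y (B^T *m x) = B^T *m x + (eta_y P)^-1 *: yk - gy.
    by rewrite /best_y scalerA mulfV ?scale1r // lt0r_neq0 ?curv_y_gt0.
  rewrite /curv_y; move: (B^T *m x) (best_y _) => v y e.
  apply/colP => i; have := congr1 (fun w : 'cV[R]_dy => w i ord0) e.
  by rewrite !mxE; lra.
(* With [y] maximized exactly, the residual in [x] is the reduced gradient. *)
have e : gx + (eta_x P)^-1 *: (x - xk) + Defs.mup P *: x + B *m best_y (B^T *m x)
    = hess *m (x - reduced_argmin).
  rewrite -reduced_grad_result /= /curv_x.
  by move: (B *m _) => w; apply/colP => i; rewrite !mxE; ring.
rewrite e.
have M0 := hess_max_gt0; have m0 := hess_min_gt0.
have Mm := hess_min_le_max; set Q := eta_x P * hess_max.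
have em : 1 <= eta_x P * hess_min.
  rewrite /hess_min /curv_x !mulrDr mulfV ?lt0r_neq0 //.
  have : 0 <= eta_x P * (lmin P / curv_y).
    by rewrite !mulr_ge0 ?invr_ge0 ?(ltW curv_y_gt0) ?(ltW ex0).
  by have := mulr_gt0 ex0 mup0; lra.
have Q1 : 1 <= Q by rewrite (le_trans em) // ler_pM2l.
have err := accel_loop_error hess_sym hess_min_gt0 hess_bounds hess_rate_gt0
  hess_rate_le1 hess_rate_sqr reduced_grad_result inner_steps xk.
have HM := sqnorm_quadratic_form_le hess_sym hess_min_gt0 hess_bounds (x - reduced_argmin).
have geo := @geometric_decay hess_rate Q inner_steps hess_rate_gt0 hess_rate_le1 Q1
  (ltW (truncnS_gt _)).
move: err HM; rewrite -/x; set z := reduced_argmin; set r := (1 - hess_rate) ^+ _.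
move=> err HM.
have r0 : 0 <= r by rewrite exprn_ge0 ?subr_ge0 ?hess_rate_le1.
have e1 : sqnorm (x - z) <= r * (2 * Q) * sqnorm (xk - z).
  have := sqnorm_ge0 (x - z); have := ler_wpM2l (ltW ex0) err.
  rewrite mulrA => h1 h2; apply: le_trans (_ : eta_x P * hess_min * sqnorm (x - z) <= _).
    by rewrite ler_peMl.
  by apply: le_trans h1 _; rewrite le_eqVlt; apply/orP; left; apply/eqP; rewrite /Q; ring.
have e2 : (1 + 3 * Q) ^+ 2 * sqnorm (x - z) <= sqnorm (xk - z).
  apply: le_trans (ler_wpM2l (sqr_ge0 _) e1) _.
  rewrite mulrA -[leRHS]mul1r ler_wpM2r ?sqnorm_ge0 //; apply: le_trans geo.
  by rewrite le_eqVlt; apply/orP; left; apply/eqP; rewrite -/r; ring.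
have e3 : sqnorm (xk - z) <= 3 * sqnorm (x - z) + 3 / 2 * sqnorm (x - xk).
  have -> : xk - z = (x - z) - (x - xk) by apply/colP => i; rewrite !mxE; ring.
  exact: sqnormB_le.
have e4 : 6 * Q ^+ 2 * sqnorm (x - z) <= sqnorm (x - xk).
  exact: stopping_scalar Q1 (sqnorm_ge0 _) e2 e3.
apply: le_trans (ler_wpM2l (ltW ex0) HM) _.
rewrite [leRHS]mulrAC mul1r ler_pdivlMr ?mulr_gt0 //; apply: le_trans e4.
by rewrite le_eqVlt; apply/orP; left; apply/eqP; rewrite /Q; ring.
Qed.

End Solver.
End SubproblemSolver.

(** * Existence of the saddle point *)

Section SaddlePoint.
Variable R : realType.
Local Open Scope classical_set_scope.

Lemma le0_geometric (x F c : R) : 0 <= c < 1 ->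
  (forall k : nat, x <= F * c ^+ k) -> x <= 0.
Proof.
move=> /andP [c0 c1] h; have lim0 : (fun k => F * c ^+ k) @ \oo --> (F * 0 : R).
  by apply: cvgM; [exact: cvg_cst|apply: cvg_expr; rewrite ger0_norm].
rewrite mulr0 in lim0; rewrite -(cvg_lim _ lim0) //; apply: limr_ge.
  by apply/cvg_ex; exists 0.
by near=> k; exact: h.
Unshelve. all: by end_near.
Qed.

(** Adding the geometric tail [D * r ^+ k] to [u] gives a nonincreasing sequence, subtracting it a
    nondecreasing one. The limit of the former lies between the two. *)
Lemma geometric_steps_cvg (u : nat -> R) (d r : R) : 0 <= d -> 0 < r < 1 ->
  (forall k, `|u k.+1 - u k| <= d * r ^+ k) ->
  exists l, forall k, `|l - u k| <= d / (1 - r) * r ^+ k.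
Proof.
move=> d0 /andP [r0 r1] ud; set D := d / (1 - r).
have D0 : 0 <= D by rewrite divr_ge0 // subr_ge0 ltW.
have DE k : D * r ^+ k - D * r ^+ k.+1 = d * r ^+ k.
  by rewrite exprS /D; field; rewrite subr_eq0 eq_sym lt_eqF.
pose a k := u k + D * r ^+ k; pose b k := u k - D * r ^+ k.
have a_dec : nonincreasing_seq a.
  apply/nonincreasing_seqP => k; have := ud k; have := DE k.
  by rewrite ler_norml /a => ? /andP [? ?]; lra.
have b_inc : nondecreasing_seq b.
  apply/nondecreasing_seqP => k; have := ud k; have := DE k.
  by rewrite ler_norml /b => ? /andP [? ?]; lra.
have ba i j : b i <= a j.
  have ab k : b k <= a k by rewrite /a /b; have := mulr_ge0 D0 (exprn_ge0 k (ltW r0)); lra.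
  apply: le_trans (b_inc _ _ (leq_maxl i j)) _.
  exact: le_trans (ab _) (a_dec _ _ (leq_maxr i j)).
have ca : cvgn a.
  by apply: nonincreasing_is_cvgn => //; exists (b 0%N) => _ [k _ <-]; exact: ba.
exists (limn a) => k; rewrite ler_norml.
have h1 : limn a <= a k by exact: nonincreasing_cvgn_ge.
have h2 : b k <= limn a by apply: limr_ge => //; apply: nearW => j; exact: ba.
by move: h1 h2; rewrite /a /b => ? ?; apply/andP; split; lra.
Qed.

(** Banach iteration in the Euclidean norm, with convergence taken coordinate by coordinate. As [c]
    contracts squared norms, the coordinates converge at the rate [Num.sqrt c]. *)
Lemma contraction_fixpoint n (T : 'cV[R]_n -> 'cV[R]_n) (c : R) : 0 < c < 1 ->
  (forall u v, sqnorm (T u - T v) <= c * sqnorm (u - v)) -> exists z, T z = z.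
Proof.
move=> /andP [c0 c1] TC; pose z k := iter k T 0; pose r := Num.sqrt c.
have r0 : 0 < r by rewrite sqrtr_gt0.
have r2 : r ^+ 2 = c by rewrite sqr_sqrtr ?ltW.
have r1 : r < 1 by rewrite -(sqrtr1 R) ltr_sqrt.
have coord (v : 'cV[R]_n) i t : 0 <= t -> sqnorm v <= t ^+ 2 -> `|v i ord0| <= t.
  move=> t0 h; rewrite -(ler_pXn2r (ltn0Sn 1)) ?nnegrE ?normr_ge0 //.
  apply: le_trans h; rewrite /sqnorm /dot (bigD1 i) //= real_normK ?num_real // expr2.
  by rewrite lerDl sumr_ge0 // => j _; rewrite -expr2 sqr_ge0.
pose d := enorm (T 0 - 0).
have d0 : 0 <= d by rewrite sqrtr_ge0.
have zd k : sqnorm (z k.+1 - z k) <= (d * r ^+ k) ^+ 2.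
  elim: k => [|k IH]; first by rewrite expr0 mulr1 sqr_sqrtr ?sqnorm_ge0.
  apply: le_trans (TC _ _) _; apply: le_trans (ler_wpM2l (ltW c0) IH) _.
  by rewrite -r2 [r ^+ k.+1]exprS le_eqVlt; apply/orP; left; apply/eqP; ring.
have zc i : exists l, forall k, `|l - z k i ord0| <= d / (1 - r) * r ^+ k.
  apply: geometric_steps_cvg; rewrite ?r0 //= => k.
  have := coord (z k.+1 - z k) i (d * r ^+ k).
  by rewrite !mxE; apply => //; rewrite mulr_ge0 ?exprn_ge0 ?(ltW r0).
have {zc} [l lP] := choice zc; pose w := \col_i l i : 'cV[R]_n.
pose E := n%:R * (d / (1 - r)) ^+ 2.
have wz k : sqnorm (w - z k) <= E * c ^+ k.
  have -> : E * c ^+ k = \sum_(i < n) (d / (1 - r) * r ^+ k) ^+ 2.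
    have -> : (d / (1 - r) * r ^+ k) ^+ 2 = (d / (1 - r)) ^+ 2 * c ^+ k.
      by rewrite exprMn -r2 -!exprM mulnC.
    by rewrite sumr_const card_ord -mulr_natl mulrA.
  apply: ler_sum => i _; rewrite -expr2 -[leLHS]real_normK ?num_real //.
  have h : `|(w - z k) i ord0| <= d / (1 - r) * r ^+ k by rewrite !mxE lP.
  by rewrite lerXn2r ?nnegrE ?normr_ge0 // (le_trans (normr_ge0 _) h).
exists w; apply/eqP; rewrite -subr_eq0 -sqnorm_eq0 eq_le sqnorm_ge0 andbT.
apply: (@le0_geometric _ (4 * E) c); first by rewrite ltW.
move=> k; have -> : T w - w = (T w - T (z k)) + (z k.+1 - w) by rewrite /= addrA subrK.
apply: le_trans (sqnormD_le _ _) _; rewrite (sqnormB_sym (z k.+1)).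
have h1 := TC w (z k); have h2 := wz k; have h3 := wz k.+1.
have h4 : c * sqnorm (w - z k) <= sqnorm (w - z k).
  by rewrite ler_piMl ?sqnorm_ge0 ?(ltW c1).
have h5 : E * c ^+ k.+1 <= E * c ^+ k.
  rewrite exprS mulrCA ler_piMl ?(ltW c1) // mulr_ge0 ?exprn_ge0 ?(ltW c0) //.
  by rewrite mulr_ge0 ?sqr_ge0.
lra.
Qed.

Lemma dot_col_mx m n (a c : 'cV[R]_m) (b d : 'cV[R]_n) :
  dot (col_mx a b) (col_mx c d) = dot a c + dot b d.
Proof.
rewrite /dot big_split_ord; congr (_ + _); apply: eq_bigr => i _.
  by rewrite !col_mxEu.
by rewrite !col_mxEd.
Qed.

Variables (dx dy : nat) (p : 'cV[R]_dx -> R) (q : 'cV[R]_dy -> R).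
Variables (B : 'M[R]_(dx, dy)) (Lp Lq mup muq : R).
Hypotheses (mup0 : 0 < mup) (muq0 : 0 < muq).
Hypotheses (pL : smooth Lp p) (pmu : strongly_convex mup p).
Hypotheses (qL : smooth Lq q) (qmu : strongly_convex muq q).

(** The zeros sought are fixed points of a forward step for the operator [F], which is strongly
    monotone because its bilinear part is skew. With modulus [mu] and squared Lipschitz constant
    [La], the step [mu / La] contracts squared distances by [1 - mu ^+ 2 / La]. *)
Lemma stationary_exists :
  exists xs ys, grad p xs + B *m ys = 0 /\ grad q ys - B^T *m xs = 0.
Proof.
have [C C0 CP] := mulmx_bounded B; have [D D0 DP] := mulmx_bounded B^T.
pose mu := Num.min mup muq; have mu0 : 0 < mu by rewrite lt_min mup0.
(* The summand [mu ^+ 2] keeps the contraction factor positive; the leading 2 comes from splitting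
   the square of a sum. *)
pose La := 2 * (Lp ^+ 2 + Lq ^+ 2 + C + D + mu ^+ 2).
have La0 : 0 < La.
  by have := exprn_gt0 2 mu0; have := sqr_ge0 Lp; have := sqr_ge0 Lq; rewrite /La; lra.
pose t := mu / La; have t0 : 0 < t by rewrite divr_gt0.
pose F (w : 'cV[R]_(dx + dy)) := col_mx (grad p (usubmx w) + B *m dsubmx w)
  (grad q (dsubmx w) - B^T *m usubmx w).
have [w wF] : exists w, w - t *: F w = w.
  apply: (@contraction_fixpoint _ _ (1 - mu ^+ 2 / La)).
    rewrite gtrBl divr_gt0 ?exprn_gt0 // subr_gt0 ltr_pdivrMr // mul1r !andbT /La.
    by have := exprn_gt0 2 mu0; have := sqr_ge0 Lp; have := sqr_ge0 Lq; lra.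
  move=> u v; rewrite -[u]vsubmxK -[v]vsubmxK /F !col_mxKu !col_mxKd.
  move: (usubmx u) (dsubmx u) (usubmx v) (dsubmx v) => x y x' y'.
  rewrite !scale_col_mx !opp_col_mx !add_col_mx opp_col_mx add_col_mx /sqnorm !dot_col_mx.
  have hp1 := dot_grad_ge pmu x x'; have hq1 := dot_grad_ge qmu y y'.
  have hp2 := grad_lipschitz pL x x'; have hq2 := grad_lipschitz qL y y'.
  have hB := CP (y - y'); have hBT := DP (x - x').
  have eB : dot (B *m y - B *m y') (x - x') = dot (B^T *m x - B^T *m x') (y - y').
    by rewrite -!mulmxBr dot_mulmx dotC.
  move: eB hB hBT hp1 hq1 hp2 hq2; rewrite !mulmxBr.
  move: (grad p x) (grad p x') (grad q y) (grad q y') (B *m y) (B *m y')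
    (B^T *m x) (B^T *m x') => gx gx' gy gy' By By' Bx Bx' eB hB hBT hp1 hq1 hp2 hq2.
  pose a := x - x'; pose b := y - y'; pose P := gx - gx'; pose Q := gy - gy'.
  pose U := By - By'; pose V := Bx - Bx'.
  rewrite (_ : _ - _ - (_ - _) = a - t *: (P + U)); last first.
    by apply/colP => i; rewrite !mxE; ring.
  rewrite (_ : _ - _ - (_ - _) = b - t *: (Q - V)); last first.
    by apply/colP => i; rewrite !mxE; ring.
  rewrite (_ : x - x' = a) // (_ : y - y' = b) //.
  move: eB hB hBT hp1 hq1 hp2 hq2; rewrite -/a -/b -/P -/Q -/U -/V.
  move: a b P Q U V => a b P Q U V eB hB hBT hp1 hq1 hp2 hq2.
  have a0 := sqnorm_ge0 a; have b0 := sqnorm_ge0 b.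
  have X : sqnorm (P + U) + sqnorm (Q - V) <= La * (sqnorm a + sqnorm b).
    have := sqnormD_le P U; have := sqnormD_le Q (- V); rewrite sqnormN /La.
    have := mulr_ge0 (sqr_ge0 Lp) b0; have := mulr_ge0 (sqr_ge0 Lq) a0.
    have := mulr_ge0 (ltW C0) a0; have := mulr_ge0 (ltW D0) b0.
    have := mulr_ge0 (sqr_ge0 mu) a0; have := mulr_ge0 (sqr_ge0 mu) b0; lra.
  have m1 : mu * sqnorm a <= dot P a.
    by apply: le_trans hp1; rewrite ler_wpM2r // ge_min lexx.
  have m2 : mu * sqnorm b <= dot Q b.
    by apply: le_trans hq1; rewrite ler_wpM2r // ge_min lexx orbT.
  have := ler_wpM2l (sqr_ge0 t) X; have := ler_wpM2l (ltW t0) (lerD m1 m2).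
  have -> : t ^+ 2 * (La * (sqnorm a + sqnorm b)) = t * (mu * (sqnorm a + sqnorm b)).
    by rewrite /t; field; exact: lt0r_neq0.
  have -> : 1 - mu ^+ 2 / La = 1 - t * mu by rewrite /t; ring.
  move: (t) eB; rewrite /sqnorm => t' eB.
  rewrite !dotE (dotC a P) (dotC a U) (dotC b Q) (dotC b V) eB (dotC U P) (dotC V Q).
  lra.
have Fw : F w = 0.
  apply/eqP; move/eqP: wF; rewrite -subr_eq0 addrAC subrr add0r oppr_eq0.
  by rewrite scaler_eq0 gt_eqF.
exists (usubmx w), (dsubmx w); move: Fw; rewrite -[0]vsubmxK => /eq_col_mx [-> ->].
by rewrite !linear0.
Qed.

Lemma stationary_saddle_point xs ys :
  grad p xs + B *m ys = 0 -> grad q ys - B^T *m xs = 0 -> saddle_point p q B xs ys.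
Proof.
move=> px qy x y; have [_ hp] := pmu; have [_ hq] := qmu.
have h1 := hp xs x; have h2 := hq ys y; have ep : grad p xs = - (B *m ys).
  by apply/eqP; rewrite -addr_eq0 px.
have eq : grad q ys = B^T *m xs by apply/eqP; rewrite -subr_eq0 qy.
have := mulr_ge0 (ltW mup0) (sqnorm_ge0 (xs - x)).
have := mulr_ge0 (ltW muq0) (sqnorm_ge0 (ys - y)).
move: h1 h2; rewrite ep eq dot_mulmx trmxK /objective !mulmxBr !dotE (dotC _ x) (dotC _ xs).
move: (p _) (p _) (q _) (q _) (dot _ _) (dot _ _) (dot _ _) (sqnorm _) (sqnorm _).
by move=> *; apply/andP; split; lra.
Qed.

End SaddlePoint.

(** * Contraction of the outer potential *)

(** The residual of the subproblem is, up to scaling, the gap between the next iterate and [xh]. So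
    the stopping criterion bounds exactly the error term of [outer_block_step]. *)
Lemma prox_residual (R : realType) n (g r x xh : 'cV[R]_n) (e : R) : 0 < e ->
  e * sqnorm (g + e^-1 *: (xh - x) + r) = e^-1 * sqnorm (x - e *: (g + r) - xh).
Proof.
move=> e0; have -> : g + e^-1 *: (xh - x) + r = - e^-1 *: (x - e *: (g + r) - xh).
  by apply/colP => i; rewrite !mxE; field; exact: lt0r_neq0.
by rewrite sqnormZ; field; exact: lt0r_neq0.
Qed.

(** Here [S] is the weighted squared distance, [D] the Bregman part, [E] the inner error, [G] the
    displacement and [H] the distance of the inexact point. Adding [a / 3 * S'] uses up [2 * c] and
    leaves [(1 + 2 * a / 3) * E], at most [5 / 18 * G], against the available [G / 3]. Finally
    [(1 - a / 4) * (1 + a / 3) >= 1] for [a <= 1]. *)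
Lemma outer_scalar_step (R : realType) (a S S' D D' E G H c : R) :
  0 < a -> a <= 1 -> 0 <= S -> 0 <= D -> 0 <= E ->
  E <= 6^-1 * G ->
  S' + D' <= S + (1 - a) * D - 2 * c + E - G + 2 / 3 * G ->
  S' <= 2 * E + 2 * H -> c = a / 3 * H ->
  (1 + a / 3) * S' + D' <= (1 - a / 4) * ((1 + a / 3) * S + D).
Proof.
move=> a0 a1 S0 D0 E0 EG main SH cE; rewrite cE in main.
have a3 : 0 <= a / 3 by rewrite divr_ge0 // ltW.
have h1 := ler_wpM2l a3 SH.
have h2 : a * E <= E by rewrite ler_piMl.
have h3 : 0 <= a * (1 - a) * S by rewrite !mulr_ge0 ?subr_ge0 // ltW.
have h4 : 0 <= a * D by rewrite mulr_ge0 // ltW.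
have e : (1 - a / 4) * ((1 + a / 3) * S + D)
    = S + (1 - a) * D + a * (1 - a) * S / 12 + 3 / 4 * (a * D) by field.
rewrite e; move: h1 main h2.
rewrite (_ : a / 3 * (2 * E + 2 * H) = 2 / 3 * (a * E) + 2 * (a / 3 * H)); last by field.
rewrite (_ : (1 + a / 3) * S' = S' + a / 3 * S'); last by ring.
move: (a / 3 * S') (a / 3 * H) (a * E) (a * (1 - a) * S) (a * D) h3 h4 => *.
lra.
Qed.

(** The smoothness term takes two thirds of the displacement term; the last third is kept for the
    inner error. *)
Lemma step_size_slack (R : realType) (L a e : R) :
  0 < e -> 3 * (L * a * e) <= 1 -> 2 * L * a <= 2 / 3 * e^-1.
Proof.
move=> e0 h; rewrite ler_pdivlMr // (_ : 2 * L * a * e = 2 * (L * a * e)); last by ring.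
lra.
Qed.

Section OuterConvergence.
Variables (R : realType) (dx dy : nat).
Variables (B : 'M[R]_(dx, dy)) (Lp Lq mup muq a ex ey : R).
Variables (p : 'cV[R]_dx -> R) (gp : 'cV[R]_dx -> 'cV[R]_dx).
Variables (q : 'cV[R]_dy -> R) (gq : 'cV[R]_dy -> 'cV[R]_dy).
Hypothesis p_lower : forall u v, p v + dot (gp v) (u - v) <= p u.
Hypothesis p_upper :
  forall u v, p u <= p v + dot (gp v) (u - v) + Lp * sqnorm (u - v).
Hypothesis q_lower : forall u v, q v + dot (gq v) (u - v) <= q u.
Hypothesis q_upper :
  forall u v, q u <= q v + dot (gq v) (u - v) + Lq * sqnorm (u - v).
Hypotheses (a0 : 0 < a) (a1 : a <= 1) (ex0 : 0 < ex) (ey0 : 0 < ey).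
Hypotheses (mex : mup * ex = a / 3) (mey : muq * ey = a / 3).
Hypotheses (Lex : 3 * (Lp * a * ex) <= 1) (Ley : 3 * (Lq * a * ey) <= 1).
Variables (xs : 'cV[R]_dx) (ys : 'cV[R]_dy).
Hypothesis p_stationary : gp xs + (mup *: xs + B *m ys) = 0.
Hypothesis q_stationary : gq ys + (muq *: ys - B^T *m xs) = 0.

Definition outer_potential (x : 'cV[R]_dx) (y : 'cV[R]_dy) xf yf : R :=
  (1 + a / 3) * (ex^-1 * sqnorm (x - xs) + ey^-1 * sqnorm (y - ys))
  + 2 / a * (bregman p gp xs xf + bregman q gq ys yf).

Lemma le_outer_potential x y xf yf :
  ex^-1 * sqnorm (x - xs) + ey^-1 * sqnorm (y - ys) <= outer_potential x y xf yf.
Proof.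
have h1 := bregman_ge0 xs p_lower xf.
have h2 := bregman_ge0 ys q_lower yf.
have h3 : 0 <= 2 / a * (bregman p gp xs xf + bregman q gq ys yf).
  by apply: mulr_ge0; [by rewrite divr_ge0 ?(ltW a0)|exact: addr_ge0].
have h4 : 0 <= a / 3 * (ex^-1 * sqnorm (x - xs) + ey^-1 * sqnorm (y - ys)).
  apply: mulr_ge0; first by rewrite divr_ge0 ?(ltW a0).
  by rewrite addr_ge0 ?mulr_ge0 ?sqnorm_ge0 ?invr_ge0 ?(ltW ex0) ?(ltW ey0).
by rewrite /outer_potential; lra.
Qed.

Lemma outer_potential_ge0 x y xf yf : 0 <= outer_potential x y xf yf.
Proof.
apply: le_trans (le_outer_potential x y xf yf).
by rewrite addr_ge0 ?mulr_ge0 ?sqnorm_ge0 ?invr_ge0 ?(ltW ex0) ?(ltW ey0).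
Qed.

Lemma outer_step (x xf xh : 'cV[R]_dx) (y yf yh : 'cV[R]_dy) :
  let xg := a *: x + (1 - a) *: xf in
  let yg := a *: y + (1 - a) *: yf in
  let gx := gp xg in
  let gy := gq yg in
  let rx := mup *: xh + B *m yh in
  let ry := muq *: yh - B^T *m xh in
  ex * sqnorm (gx + ex^-1 *: (xh - x) + rx)
  + ey * sqnorm (gy + ey^-1 *: (yh - y) + ry)
  <= 1 / (6 * ex) * sqnorm (xh - x) + 1 / (6 * ey) * sqnorm (yh - y) ->
  outer_potential (x - ex *: (gx + rx)) (y - ey *: (gy + ry))
    (xg + a *: (xh - x)) (yg + a *: (yh - y))
  <= (1 - a / 4) * outer_potential x y xf yf.
Proof.
move=> xg yg gx gy rx ry acc.
have := outer_block_step x xf xh rx a0 a1 ex0 p_lower p_upper p_stationary.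
have := outer_block_step y yf yh ry a0 a1 ey0 q_lower q_upper q_stationary.
rewrite -/xg -/yg -/gx -/gy.
have hx := sqnormD_le (x - ex *: (gx + rx) - xh) (xh - xs).
have hy := sqnormD_le (y - ey *: (gy + ry) - yh) (yh - ys).
have fx := prox_residual gx rx x xh ex0; have fy := prox_residual gy ry y yh ey0.
(* The bilinear contributions of the two blocks cancel. *)
have coup : dot (rx - (mup *: xs + B *m ys)) (xh - xs)
    + dot (ry - (muq *: ys - B^T *m xs)) (yh - ys)
    = mup * sqnorm (xh - xs) + muq * sqnorm (yh - ys).
  rewrite /rx /ry.
  have e : dot (B *m yh - B *m ys) (xh - xs) = dot (B^T *m xh - B^T *m xs) (yh - ys).
    by rewrite -!mulmxBr dot_mulmx dotC.
  rewrite (_ : _ - _ = mup *: (xh - xs) + (B *m yh - B *m ys)); last first.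
    by apply/colP => i; rewrite !mxE; ring.
  rewrite (_ : _ - (_ - _) = muq *: (yh - ys) - (B^T *m xh - B^T *m xs)); last first.
    by apply/colP => i; rewrite !mxE; ring.
  by rewrite !(dotDl (_ *: _)) dotNl e !dotZl /sqnorm; ring.
rewrite !subrKA in hx hy.
move: acc; rewrite fx fy.
have [Lix Liy]: 2 * Lp * a <= 2 / 3 * ex^-1 /\ 2 * Lq * a <= 2 / 3 * ey^-1.
  by split; exact: step_size_slack.
have iex : mup = a / 3 * ex^-1 by rewrite -mex mulfK ?lt0r_neq0.
have iey : muq = a / 3 * ey^-1 by rewrite -mey mulfK ?lt0r_neq0.
have {}Lix : 2 * Lp * a * sqnorm (xh - x) <= 2 / 3 * (ex^-1 * sqnorm (xh - x)).
  by rewrite mulrA ler_wpM2r ?sqnorm_ge0.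
have {}Liy : 2 * Lq * a * sqnorm (yh - y) <= 2 / 3 * (ey^-1 * sqnorm (yh - y)).
  by rewrite mulrA ler_wpM2r ?sqnorm_ge0.
have ix0 : 0 <= ex^-1 by rewrite invr_ge0 ltW.
have iy0 : 0 <= ey^-1 by rewrite invr_ge0 ltW.
have D0 : 0 <= 2 / a * (bregman p gp xs xf + bregman q gq ys yf).
  apply: mulr_ge0; first by rewrite divr_ge0 ?(ltW a0).
  by apply: addr_ge0; apply: bregman_ge0.
have S0 : 0 <= ex^-1 * sqnorm (x - xs) + ey^-1 * sqnorm (y - ys).
  by rewrite addr_ge0 ?mulr_ge0 ?sqnorm_ge0.
have E0 : 0 <= ex^-1 * sqnorm (x - ex *: (gx + rx) - xh)
             + ey^-1 * sqnorm (y - ey *: (gy + ry) - yh).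
  by rewrite addr_ge0 ?mulr_ge0 ?sqnorm_ge0.
move=> acc by_ bx; move: acc.
have := ler_wpM2l ix0 hx; rewrite mulrDr ![_^-1 * (2 * _)]mulrCA => {}hx.
have := ler_wpM2l iy0 hy; rewrite mulrDr ![_^-1 * (2 * _)]mulrCA => {}hy.
rewrite (_ : 1 / (6 * ex) = 6^-1 * ex^-1); last by rewrite div1r invfM.
rewrite (_ : 1 / (6 * ey) = 6^-1 * ey^-1); last by rewrite div1r invfM.
rewrite -!mulrA => acc.
(* The balance [mup * ex = muq * ey = a / 3] gives both blocks the weights of the potential. *)
have {}coup : dot (rx - (mup *: xs + B *m ys)) (xh - xs)
    + dot (ry - (muq *: ys - B^T *m xs)) (yh - ys)
    = a / 3 * (ex^-1 * sqnorm (xh - xs) + ey^-1 * sqnorm (yh - ys)).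
  by rewrite coup {1}iex {1}iey; ring.
rewrite /outer_potential.
pose G := ex^-1 * sqnorm (xh - x) + ey^-1 * sqnorm (yh - y).
apply: (@outer_scalar_step _ _ _ _ _ _ _ G _ _ a0 a1 S0 D0 E0 _ _ _ coup).
- by rewrite /G mulrDr.
- move: Lix Liy bx by_; rewrite /G.
  move: (bregman _ _ xs xf) (bregman _ _ ys yf).
  move: (bregman _ _ xs _) (bregman _ _ ys _) => ? ? ? ?.
  rewrite !mulrDr; lra.
- move: hx hy; lra.
Qed.

End OuterConvergence.

(** * Step sizes and rates *)

Section StepSizeBounds.
Variable R : realType.

(** Index 1 is the worse conditioned block, so one statement serves both branches of the parameter
    choice. Since [m1 = L1 * a ^+ 2 <= L1 * a], each minimum is attained by its second argument. *)
Lemma dominant_step_sizes (L1 m1 L2 m2 a e1 e2 : R) :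
  0 < m1 -> m1 <= L1 -> 0 < m2 -> m2 <= L2 -> L2 / m2 <= L1 / m1 ->
  a = Num.min 1 (Num.sqrt (m1 / L1)) ->
  e1 = Num.min (1 / (3 * m1)) (1 / (3 * L1 * a)) -> e2 = m1 / m2 * e1 ->
  [/\ 0 < a, a <= 1, m1 * e1 = a / 3, m2 * e2 = a / 3 &
    [/\ 3 * (L1 * a * e1) <= 1, 3 * (L2 * a * e2) <= 1,
        Num.sqrt (L1 / m1) = a^-1 & Num.sqrt (L2 / m2) <= a^-1]].
Proof.
move=> m10 mL1 m20 mL2 dom aE e1E e2E.
have L10 : 0 < L1 by exact: lt_le_trans mL1.
have s1 : Num.sqrt (m1 / L1) <= 1.
  by rewrite -(sqrtr1 R) ler_wsqrtr // ler_pdivrMr // mul1r.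
have {}aE : a = Num.sqrt (m1 / L1) by rewrite aE min_r.
have a0 : 0 < a by rewrite aE sqrtr_gt0 divr_gt0.
have a2 : L1 * a ^+ 2 = m1.
  by rewrite aE sqr_sqrtr ?divr_ge0 ?(ltW m10) ?(ltW L10) // mulrC divfK ?lt0r_neq0.
have a1 : a <= 1 by rewrite aE.
have {}e1E : e1 = 1 / (3 * L1 * a).
  rewrite e1E min_r // !div1r lef_pV2 ?posrE ?mulr_gt0 // -mulrA ler_pM2l // -a2.
  by rewrite ler_pM2l // expr2 ler_piMl ?(ltW a0).
have r1 : Num.sqrt (L1 / m1) = a^-1 by rewrite aE -sqrtrV ?invf_div // divr_ge0 ?ltW.
have nz := (lt0r_neq0 a0, lt0r_neq0 L10, lt0r_neq0 m20).
split=> //.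
- by rewrite e1E -a2; field; rewrite !nz.
- by rewrite e2E e1E -a2; field; rewrite !nz.
split=> //; last by rewrite -r1 ler_wsqrtr.
- by rewrite e1E (_ : 3 * _ = 1) //; field; rewrite !nz.
rewrite e2E e1E (_ : 3 * _ = (L2 / m2) * (m1 / L1)); last by field; rewrite !nz.
rewrite -(@divff _ (L1 / m1)) ?mulf_neq0 ?invr_eq0 ?lt0r_neq0 // invf_div.
by rewrite ler_wpM2r // divr_ge0 ?ltW.
Qed.

(** * Step sizes, conditioning of the reduced Hessian and inner iteration count *)

Variable P : params R.
Hypotheses (mup0 : 0 < Defs.mup P) (muq0 : 0 < muq P).
Hypotheses (mLp : Defs.mup P <= Defs.Lp P) (mLq : muq P <= Lq P).

Lemma step_sizes : let a := alpha P in
  [/\ 0 < a, a <= 1, Defs.mup P * eta_x P = a / 3, muq P * eta_y P = a / 3 &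
    [/\ 3 * (Defs.Lp P * a * eta_x P) <= 1, 3 * (Lq P * a * eta_y P) <= 1 &
        Num.max (Num.sqrt (Defs.Lp P / Defs.mup P)) (Num.sqrt (Lq P / muq P)) = a^-1]].
Proof.
rewrite /= /eta_x /eta_y /eta_x_dom /eta_y_dom /alpha; case: ifPn => dom.
  have [a0 a1 ? ? [? ? r1 r2]] :=
    dominant_step_sizes mup0 mLp muq0 mLq dom erefl erefl erefl.
  by split=> //; split=> //; rewrite r1 max_l.
have {}dom : Defs.Lp P / Defs.mup P <= Lq P / muq P.
  by move: dom; rewrite /p_dominates -ltNge => /ltW.
have [a0 a1 ? ? [? ? r1 r2]] :=
  dominant_step_sizes muq0 mLq mup0 mLp dom erefl erefl erefl.
by split=> //; split=> //; rewrite r1 max_r.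
Qed.

Lemma alpha_gt0 : 0 < alpha P. Proof. by case: step_sizes. Qed.
Lemma alpha_le1 : alpha P <= 1. Proof. by case: step_sizes. Qed.

Lemma eta_xE : eta_x P = alpha P / 3 / Defs.mup P.
Proof. by case: step_sizes => _ _ <- _ _; rewrite mulrC mulKf ?lt0r_neq0. Qed.

Lemma eta_yE : eta_y P = alpha P / 3 / muq P.
Proof. by case: step_sizes => _ _ _ <- _; rewrite mulrC mulKf ?lt0r_neq0. Qed.

Lemma eta_x_gt0 : 0 < eta_x P.
Proof. by rewrite eta_xE !divr_gt0 ?alpha_gt0. Qed.

Lemma eta_y_gt0 : 0 < eta_y P.
Proof. by rewrite eta_yE !divr_gt0 ?alpha_gt0. Qed.

Lemma grad_rateE : grad_rate P = (alpha P)^-1.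
Proof.
case: step_sizes => a0 a1 _ _ [_ _ e]; rewrite /grad_rate e max_r //.
by rewrite invf_ge1.
Qed.

Hypotheses (lmin0 : 0 <= lmin P) (lminmax : lmin P <= lmax P).

Let cx0 := curv_x_gt0 mup0 eta_x_gt0.
Let cy0 := curv_y_gt0 muq0 eta_y_gt0.

Lemma hess_ratio :
  hess_max P / hess_min P
  = (curv_x P * curv_y P + lmax P) / (curv_x P * curv_y P + lmin P).
Proof.
have h : 0 < curv_x P * curv_y P + lmin P by rewrite ltr_pwDl ?mulr_gt0.
rewrite /hess_max /hess_min; field.
by rewrite !lt0r_neq0.
Qed.

Lemma curv_mul_ge : 9 * (Defs.mup P * muq P) / alpha P ^+ 2 <= curv_x P * curv_y P.
Proof.
have a0 := alpha_gt0.
rewrite /curv_x /curv_y eta_xE eta_yE.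
rewrite (_ : _ / _ ^+ 2 = (alpha P / 3 / Defs.mup P)^-1 * (alpha P / 3 / muq P)^-1).
  by rewrite ler_pM ?invr_ge0 ?divr_ge0 ?(ltW a0) ?(ltW mup0) ?(ltW muq0) // lerDr ltW.
by field; rewrite !lt0r_neq0.
Qed.

Lemma sqrtr_bound (x y : R) : 0 <= y -> x <= y ^+ 2 -> Num.sqrt x <= y.
Proof. by move=> y0 xy; rewrite -(ger0_norm y0) -sqrtr_sqr ler_wsqrtr. Qed.

Lemma inv_hess_rate : (hess_rate P)^-1 = Num.sqrt (hess_max P / hess_min P).
Proof.
rewrite /hess_rate -sqrtrV ?invf_div // divr_ge0 ?ltW //.
  exact: hess_min_gt0 mup0 muq0 eta_x_gt0 eta_y_gt0 lmin0.
exact: hess_max_gt0 mup0 muq0 eta_x_gt0 eta_y_gt0 lmin0 lminmax.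
Qed.

(** Dropping [lmin P] from the denominator bounds the condition number by [1 + alpha P ^+ 2 * (lmax
    P / (mup P * muq P))]. Both summands are at most [alpha P ^+ 2 * K2 P ^+ 2], the first one
    because [K2 P] is at least the inverse of [alpha P]. *)
Lemma rate_K2 : (alpha P * hess_rate P)^-1 <= 2 * K2 P.
Proof.
have a0 := alpha_gt0; have [_ _ _ _ [_ _ ra]] := step_sizes.
set s := Num.sqrt (lmax P / (Defs.mup P * muq P)).
have K2E : K2 P = Num.max (alpha P)^-1 s by rewrite /K2 maxA ra.
have K0 : 0 < K2 P by rewrite K2E lt_max invr_gt0 a0.
have h1 : (alpha P)^-1 ^+ 2 <= K2 P ^+ 2.
  by rewrite lerXn2r ?nnegrE ?invr_ge0 ?(ltW a0) ?(ltW K0) // K2E le_max lexx.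
have mm : 0 < Defs.mup P * muq P by rewrite mulr_gt0.
have lm0 : 0 <= lmax P by exact: le_trans lminmax.
have h2 : lmax P / (Defs.mup P * muq P) <= K2 P ^+ 2.
  rewrite -[leLHS]sqr_sqrtr ?divr_ge0 ?(ltW mm) // -/s.
  by rewrite lerXn2r ?nnegrE ?sqrtr_ge0 ?(ltW K0) // K2E le_max lexx orbT.
rewrite invfM inv_hess_rate hess_ratio -ler_pdivlMl ?invr_gt0 // invrK.
apply: sqrtr_bound; first by rewrite !mulr_ge0 ?(ltW a0) ?(ltW K0).
have cc : 0 < curv_x P * curv_y P by rewrite mulr_gt0.
have h3 : (curv_x P * curv_y P + lmax P) / (curv_x P * curv_y P + lmin P)
    <= 1 + lmax P / (curv_x P * curv_y P).
  move: (curv_x P * curv_y P) cc => c cc.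
  rewrite ler_pdivrMr ?ltr_pwDl // mulrDl mul1r [_ * (c + _)]mulrDr divfK ?lt0r_neq0 //.
  have : 0 <= lmax P / c * lmin P by rewrite !mulr_ge0 ?invr_ge0 ?(ltW cc).
  move: (_ / _ * _) lmin0 => z l0 z0; lra.
have h4 : lmax P / (curv_x P * curv_y P)
    <= alpha P ^+ 2 * (lmax P / (Defs.mup P * muq P)).
  rewrite mulrCA ler_wpM2l // -[leRHS]invrK.
  rewrite lef_pV2 ?posrE ?invr_gt0 ?mulr_gt0 ?exprn_gt0 ?invr_gt0 //.
  rewrite invfM invrK mulrC; apply: le_trans curv_mul_ge.
  by rewrite ler_wpM2r ?invr_ge0 ?sqr_ge0 // ler_peMl ?(ltW mm) //; lra.
apply: le_trans h3 _.
rewrite (_ : (_ * _) ^+ 2 = 4 * (alpha P ^+ 2 * K2 P ^+ 2)); last by ring.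
have h5 := ler_wpM2l (sqr_ge0 (alpha P)) h2.
have h6 := ler_wpM2l (sqr_ge0 (alpha P)) h1.
move: h6; rewrite (_ : alpha P ^+ 2 * (alpha P)^-1 ^+ 2 = 1); last first.
  by rewrite -exprMn mulfV ?expr1n ?lt0r_neq0.
move: h4 h5; move: (alpha P ^+ 2 * K2 P ^+ 2) (alpha P ^+ 2 * _) (lmax P / _) => *; lra.
Qed.

(** Adding the same positive number to both terms of [lmax P / lmin P], a ratio of at least 1, does
    not increase it. *)
Lemma rate_K1 : 0 < lmin P -> (alpha P * hess_rate P)^-1 <= K1 P.
Proof.
move=> lmin_gt0; have a0 := alpha_gt0; have [_ _ _ _ [_ _ ra]] := step_sizes.
have Lp0 : 0 < Defs.Lp P by exact: lt_le_trans mLp.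
have Lq0 : 0 < Lq P by exact: lt_le_trans mLq.
have lm0 : 0 < lmax P by exact: lt_le_trans lminmax.
have K1E : K1 P = (alpha P)^-1 * Num.sqrt (lmax P / lmin P).
  rewrite -ra maxr_pMl ?sqrtr_ge0 // /K1.
  rewrite -!sqrtrM ?divr_ge0 ?(ltW Lp0) ?(ltW Lq0) ?(ltW mup0) ?(ltW muq0) //.
  by congr Num.max; congr Num.sqrt; field; rewrite !lt0r_neq0.
rewrite K1E invfM inv_hess_rate hess_ratio ler_pM2l ?invr_gt0 // ler_wsqrtr //.
have cc : 0 < curv_x P * curv_y P by rewrite mulr_gt0.
move: (curv_x P * curv_y P) cc => c0 cc.
rewrite ler_pdivrMr ?ltr_pwDl // mulrDr divfK ?lt0r_neq0 // lerD2r.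
by rewrite ler_peMl ?(ltW cc) // ler_pdivlMr // mul1r.
Qed.

Lemma rate_B_ge : (alpha P * hess_rate P)^-1 <= 2 * rate_B P.
Proof.
rewrite /rate_B; case: eqVneq => [_|ln0]; first exact: rate_K2.
have lp : 0 < lmin P by rewrite lt0r ln0.
have h1 := rate_K1 lp; have h2 := rate_K2.
have h0 : 0 < (alpha P * hess_rate P)^-1.
  by rewrite invr_gt0 mulr_gt0 ?alpha_gt0 // hess_rate_gt0 // ?eta_x_gt0 ?eta_y_gt0.
by case: (leP (K1 P) (K2 P)) => _; [lra|].
Qed.

Lemma log_factor_ge1 (t : R) : 1 <= log_factor t.
Proof. by rewrite le_max lexx. Qed.

Lemma expR_log_factor_ge (t : R) : t <= expR (log_factor t).
Proof.
have [t0|t0] := lerP t 0; first exact: le_trans t0 (expR_ge0 _).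
by rewrite -{1}(lnK t0) ler_expR le_max lexx orbT.
Qed.

Let t := Num.sqrt (lmax P) / Num.min (Defs.mup P) (muq P).

(** The left side is at most [4 * (4 / 3 + t ^+ 2 / 9)]. With [l] the logarithmic factor, this is at
    most 6 times [expR l ^+ 2], and [6 <= 1 + 5 * l <= expR (5 * l)]; hence [7 = 5 + 2]. *)
Lemma eta_hess_max_le : 4 * (eta_x P * hess_max P) <= expR (7 * log_factor t).
Proof.
have a0 := alpha_gt0; have a1 := alpha_le1.
set m := Num.min (Defs.mup P) (muq P).
have m0 : 0 < m by rewrite lt_min mup0.
have lm0 : 0 <= lmax P by exact: le_trans lminmax.
have t0 : 0 <= t by rewrite divr_ge0 ?sqrtr_ge0 ?(ltW m0).
have mm : m ^+ 2 <= Defs.mup P * muq P.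
  by rewrite expr2 ler_pM ?(ltW m0) // ge_min lexx ?orbT.
have h1 : eta_x P * (lmax P / curv_y P) <= t ^+ 2 / 9.
  have e1 : eta_x P * (lmax P / curv_y P) <= lmax P * (eta_x P * eta_y P).
    rewrite mulrCA ler_wpM2l // ler_wpM2l ?(ltW eta_x_gt0) // -[leRHS]invrK.
    by rewrite lef_pV2 ?posrE ?invr_gt0 ?eta_y_gt0 // lerDr ltW.
  apply: le_trans e1 _.
  rewrite /t exprMn sqr_sqrtr // exprVn -mulrA ler_wpM2l // eta_xE eta_yE.
  rewrite (_ : _ * _ = alpha P ^+ 2 / 9 * (Defs.mup P * muq P)^-1); last first.
    by field; rewrite !lt0r_neq0.
  rewrite [leRHS]mulrC ler_pM ?invr_ge0 ?divr_ge0 ?sqr_ge0 ?mulr_ge0 ?(ltW mup0) ?(ltW muq0) //.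
    by rewrite ler_pdivrMr // mulVf // exprn_ile1 // ltW.
  by rewrite lef_pV2 ?posrE ?exprn_gt0 ?mulr_gt0.
have h2 : eta_x P * curv_x P <= 4 / 3.
  rewrite /curv_x mulrDr mulfV ?lt0r_neq0 ?eta_x_gt0 // eta_xE divfK ?lt0r_neq0 //; lra.
have l1 := log_factor_ge1 t.
have e2 : t <= expR (log_factor t) by exact: expR_log_factor_ge.
have e3 : 1 <= expR (log_factor t) by rewrite -expR0 ler_expR; lra.
have e5 : 6 <= expR (log_factor t) ^+ 5.
  rewrite -expRM_natl; apply: le_trans (expR_ge1Dx _); lra.
have -> : expR (7 * log_factor t) = expR (log_factor t) ^+ 5 * expR (log_factor t) ^+ 2.
  by rewrite -exprD -expRM_natl.
have e6 : t ^+ 2 <= expR (log_factor t) ^+ 2 by rewrite lerXn2r ?nnegrE ?expR_ge0.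
have e7 : 1 <= expR (log_factor t) ^+ 2 by rewrite exprn_ege1.
apply: le_trans (ler_wpM2r _ e5); last by rewrite sqr_ge0.
rewrite /hess_max mulrDr; move: h1 h2 e6 e7.
move: (eta_x P * _) (eta_x P * _) (t ^+ 2) (expR _ ^+ 2) => *; lra.
Qed.

(** The left side counts the products of one outer iteration: two per inner step, one for the final
    [best_y], two for the update. With [X] the quotient on the right, which is at least 1, it is at
    most [2 * (21 * X + 1) + 3], hence at most [47 * X]. *)
Lemma inner_steps_le :
  (2 * inner_steps P + 3)%:R <= 47 * (log_factor t / hess_rate P).
Proof.
have th0 := hess_rate_gt0 mup0 muq0 eta_x_gt0 eta_y_gt0 lmin0 lminmax.
have th1 := hess_rate_le1 mup0 muq0 eta_x_gt0 eta_y_gt0 lmin0 lminmax.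
have l1 := log_factor_ge1 t.
have M0 := hess_max_gt0 mup0 muq0 eta_x_gt0 eta_y_gt0 lmin0 lminmax.
have Q0 : 0 < 4 * (eta_x P * hess_max P) by rewrite !mulr_gt0 ?eta_x_gt0.
have lnQ : ln (4 * (eta_x P * hess_max P)) <= 7 * log_factor t.
  by rewrite -[leRHS]expRK ler_ln ?posrE ?expR_gt0 // eta_hess_max_le.
have X0 : 0 <= 21 * (log_factor t / hess_rate P).
  by rewrite !mulr_ge0 ?invr_ge0 ?(ltW th0) //; lra.
have X1 : log_factor t <= log_factor t / hess_rate P.
  by rewrite ler_pdivlMr // ler_piMr //; lra.
have X2 : 3 * ln (4 * (eta_x P * hess_max P)) / hess_rate P
    <= 21 * (log_factor t / hess_rate P).
  rewrite [leRHS]mulrA ler_wpM2r ?invr_ge0 ?(ltW th0) //; lra.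
have : (inner_steps P)%:R <= 21 * (log_factor t / hess_rate P) + 1.
  rewrite /inner_steps -addn1 natrD lerD2r.
  by apply: le_trans (_ : (Num.truncn (21 * (log_factor t / hess_rate P)))%:R <= _);
    [rewrite ler_nat le_truncn | rewrite truncn_le].
rewrite natrD natrM; move: X1; move: (_ / hess_rate P) => *; lra.
Qed.

End StepSizeBounds.

(** * The complete algorithm *)

Section Correctness.
Variables (R : realType) (dx dy : nat) (P : params R).
Variables (p : 'cV[R]_dx -> R) (q : 'cV[R]_dy -> R) (B : 'M[R]_(dx, dy)).
Hypotheses (mup0 : 0 < Defs.mup P) (muq0 : 0 < muq P).
Hypotheses (pL : smooth (Defs.Lp P) p) (pmu : strongly_convex (Defs.mup P) p).
Hypotheses (qL : smooth (Lq P) q) (qmu : strongly_convex (muq P) q).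
Hypotheses (mLp : Defs.mup P <= Defs.Lp P) (mLq : muq P <= Lq P).
Hypotheses (lmin0 : 0 <= lmin P) (lminmax : lmin P <= lmax P).
Hypothesis BP :
  forall v, lmin P * sqnorm v <= dot (B *m B^T *m v) v <= lmax P * sqnorm v.

Let ex0 : 0 < eta_x P := eta_x_gt0 mup0 muq0 mLp mLq.
Let ey0 : 0 < eta_y P := eta_y_gt0 mup0 muq0 mLp mLq.

Lemma grad_shifted n (f : 'cV[R]_n -> R) (mu : R) (x : 'cV[R]_n) :
  (forall u, differentiable f u) ->
  grad (fun u => f u - mu / 2 * sqnorm u) x = grad f x - mu *: x.
Proof.
move=> df; have := grad_add_quadratic (- (mu / 2)) 0 0 (df x).
have -> : (fun u => f u + (- (mu / 2) * sqnorm u + dot 0 u + 0))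
    = (fun u => f u - mu / 2 * sqnorm u).
  by apply/funext => u; rewrite dot0l !addr0 mulNr.
by move=> ->; congr (_ + _); apply/colP => i; rewrite !mxE; field.
Qed.

Lemma grad_coupling_x xh yh :
  grad (fun x => coupling B P x yh) xh = Defs.mup P *: xh + B *m yh.
Proof.
have -> : (fun x => coupling B P x yh) = (fun x => Defs.mup P / 2 * sqnorm x
    + dot (B *m yh) x + - (muq P / 2 * sqnorm yh)).
  by apply/funext => x; rewrite /coupling (dotC x).
by rewrite grad_quadratic mulrC divfK ?pnatr_eq0.
Qed.

Lemma grad_coupling_y xh yh :
  grad (fun y => coupling B P xh y) yh = B^T *m xh - muq P *: yh.
Proof.
have -> : (fun y => coupling B P xh y) = (fun y => - (muq P / 2) * sqnorm y
    + dot (B^T *m xh) y + (Defs.mup P / 2 * sqnorm xh)).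
  by apply/funext => y; rewrite /coupling (dot_mulmx B^T) trmxK; ring.
rewrite grad_quadratic addrC; congr (_ + _).
by apply/colP => i; rewrite !mxE; field.
Qed.

Lemma grad_subproblem_x s xh yh :
  grad (fun x => subproblem p q B P s x yh) xh
  = grad (p_tilde p P) (xg P s) + (eta_x P)^-1 *: (xh - st_x s)
    + (Defs.mup P *: xh + B *m yh).
Proof.
rewrite /subproblem; move: (grad _ (xg P s)) (grad _ (yg P s)) => gx gy.
have -> : (fun x => dot gx x + 1 / (2 * eta_x P) * sqnorm (x - st_x s)
    + coupling B P x yh - dot gy yh - 1 / (2 * eta_y P) * sqnorm (yh - st_y s))
  = (fun x => (1 / (2 * eta_x P) + Defs.mup P / 2) * sqnorm x
    + dot (gx - (eta_x P)^-1 *: st_x s + B *m yh) x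
    + (1 / (2 * eta_x P) * sqnorm (st_x s) - muq P / 2 * sqnorm yh
       - dot gy yh - 1 / (2 * eta_y P) * sqnorm (yh - st_y s))).
  apply/funext => x; rewrite /coupling (dotC x (B *m yh)).
  move: (sqnorm (yh - _)) (B *m yh) (st_x s) => t w z.
  by rewrite /sqnorm !dotE (dotC z x); field; rewrite !lt0r_neq0.
rewrite grad_quadratic; move: (B *m yh) (st_x s) => w z.
by apply/colP => i; rewrite !mxE; field; exact: lt0r_neq0.
Qed.

Lemma grad_subproblem_y s xh yh :
  grad (fun y => subproblem p q B P s xh y) yh
  = - (grad (q_tilde q P) (yg P s) + (eta_y P)^-1 *: (yh - st_y s)
       + (muq P *: yh - B^T *m xh)).
Proof.
rewrite /subproblem; move: (grad _ (xg P s)) (grad _ (yg P s)) => gx gy.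
have -> : (fun y => dot gx xh + 1 / (2 * eta_x P) * sqnorm (xh - st_x s)
    + coupling B P xh y - dot gy y - 1 / (2 * eta_y P) * sqnorm (y - st_y s))
  = (fun y => - (1 / (2 * eta_y P) + muq P / 2) * sqnorm y
    + dot (- gy + (eta_y P)^-1 *: st_y s + B^T *m xh) y
    + (dot gx xh + 1 / (2 * eta_x P) * sqnorm (xh - st_x s)
       + Defs.mup P / 2 * sqnorm xh - 1 / (2 * eta_y P) * sqnorm (st_y s))).
  apply/funext => y; rewrite /coupling (_ : dot xh (B *m y) = dot (B^T *m xh) y).
    move: (sqnorm (xh - _)) (B^T *m xh) (st_y s) => t w z.
    by rewrite /sqnorm !dotE (dotC z y); field; rewrite !lt0r_neq0.
  by rewrite dot_mulmx trmxK.
rewrite grad_quadratic; move: (B^T *m xh) (st_y s) => w z.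
by apply/colP => i; rewrite !mxE; field; exact: lt0r_neq0.
Qed.

Lemma result_iteration_prog (solve : inner_solver R) s :
  let gx := grad p (xg P s) - Defs.mup P *: xg P s in
  let gy := grad q (yg P s) - muq P *: yg P s in
  let z := result p q B (solve dx dy P (st_x s) (st_y s) gx gy) in
  result p q B (iteration_prog solve P s)
  = State (st_x s - eta_x P *: (gx + (Defs.mup P *: z.1 + B *m z.2)))
      (st_y s - eta_y P *: (gy + (muq P *: z.2 - B^T *m z.1)))
      (xg P s + alpha P *: (z.1 - st_x s)) (yg P s + alpha P *: (z.2 - st_y s)).
Proof.
by rewrite /= result_bind; case: (result p q B (solve _ _ _ _ _ _ _)) => xh yh /=; rewrite opprB.
Qed.

Lemma grad_calls_iteration_prog (solve : inner_solver R) s :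
  (forall gx gy, products_only (solve dx dy P (st_x s) (st_y s) gx gy)) ->
  grad_calls p q B (iteration_prog solve P s) = 2%N.
Proof.
move=> h; rewrite /= grad_calls_bind products_only_grad_calls //.
by case: (result p q B (solve _ _ _ _ _ _ _)).
Qed.

Lemma product_calls_iteration_prog (solve : inner_solver R) s c :
  (forall gx gy,
     product_calls p q B (solve dx dy P (st_x s) (st_y s) gx gy) = c) ->
  product_calls p q B (iteration_prog solve P s) = (c + 2)%N.
Proof.
by move=> h; rewrite /= product_calls_bind h; case: (result p q B (solve _ _ _ _ _ _ _)).
Qed.

Lemma iteration_prog_spec s : exists xh yh,
  let gx := grad p (xg P s) - Defs.mup P *: xg P s in
  let gy := grad q (yg P s) - muq P *: yg P s in
  let rx := Defs.mup P *: xh + B *m yh in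
  let ry := muq P *: yh - B^T *m xh in
  eta_x P * sqnorm (gx + (eta_x P)^-1 *: (xh - st_x s) + rx)
  + eta_y P * sqnorm (gy + (eta_y P)^-1 *: (yh - st_y s) + ry)
  <= 1 / (6 * eta_x P) * sqnorm (xh - st_x s)
     + 1 / (6 * eta_y P) * sqnorm (yh - st_y s) /\
  result p q B (iteration_prog (@accel_solve R) P s)
  = State (st_x s - eta_x P *: (gx + rx)) (st_y s - eta_y P *: (gy + ry))
      (xg P s + alpha P *: (xh - st_x s)) (yg P s + alpha P *: (yh - st_y s)).
Proof.
rewrite result_iteration_prog; move: (grad p _) (grad q _) => gp gq.
case E : (result p q B (accel_solve _ _ _ _ _)) => [xh yh]; exists xh, yh; split=> //.
have [ry rx] := accel_solve_accurate mup0 muq0 ex0 ey0 lmin0 lminmax BP E.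
(* Exact maximization in [y] makes the second residual vanish, so the bound in [x] alone implies the
   criterion. *)
rewrite (_ : _ - _ + (eta_y P)^-1 *: _ + _ = 0); last first.
  apply/eqP; rewrite -oppr_eq0 -ry; apply/eqP.
  move: (B^T *m xh) => w; apply/colP => i; rewrite !mxE; ring.
rewrite {2}/sqnorm dot0l mulr0 addr0 (addrA _ _ (B *m yh)).
apply: le_trans rx _; rewrite lerDl mulr_ge0 ?sqnorm_ge0 // divr_ge0 //.
by rewrite mulr_ge0 ?(ltW ey0).
Qed.

Lemma iteration_prog_iteration s :
  iteration p q B P s (result p q B (iteration_prog (@accel_solve R) P s)).
Proof.
have [dp _] := pL; have [dq _] := qL.
have [xh [yh [acc ->]]] := iteration_prog_spec s; exists xh, yh.
have gpE : grad (p_tilde p P) (xg P s) = grad p (xg P s) - Defs.mup P *: xg P s.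
  exact: grad_shifted.
have gqE : grad (q_tilde q P) (yg P s) = grad q (yg P s) - muq P *: yg P s.
  exact: grad_shifted.
split; last by rewrite grad_coupling_x grad_coupling_y gpE gqE opprB.
by rewrite /accurate grad_subproblem_x grad_subproblem_y sqnormN gpE gqE.
Qed.

(** * Call counts and convergence of the whole run *)

Variables (x0 : 'cV[R]_dx) (y0 : 'cV[R]_dy).
Let alg := algorithm (@accel_solve R) P x0 y0.
Let iterate k := result p q B (alg k).

Lemma iterateS k :
  iterate k.+1 = result p q B (iteration_prog (@accel_solve R) P (iterate k)).
Proof. exact: result_bind. Qed.

Lemma grad_calls_algorithm k : grad_calls p q B (alg k) = (k * 2)%N.
Proof.
elim: k => // k IH.
rewrite (_ : alg k.+1 = bind (alg k) (iteration_prog (@accel_solve R) P)) //.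
rewrite grad_calls_bind IH grad_calls_iteration_prog ?mulSnr // => *.
exact: products_only_accel_solve.
Qed.

Lemma product_calls_algorithm k :
  product_calls p q B (alg k) = (k * (2 * inner_steps P + 3))%N.
Proof.
elim: k => // k IH.
rewrite (_ : alg k.+1 = bind (alg k) (iteration_prog (@accel_solve R) P)) //.
rewrite product_calls_bind IH.
rewrite (product_calls_iteration_prog (c := (2 * inner_steps P).+1)) => [|*].
  by rewrite addSnnS (mulSnr k).
exact: product_calls_accel_solve.
Qed.

Variables (xs : 'cV[R]_dx) (ys : 'cV[R]_dy).
Hypotheses (pxs : grad p xs + B *m ys = 0) (qys : grad q ys - B^T *m xs = 0).

Definition potential (s : state R dx dy) : R :=
  outer_potential (alpha P) (eta_x P) (eta_y P)
    (fun u => p u - Defs.mup P / 2 * sqnorm u) (fun u => grad p u - Defs.mup P *: u)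
    (fun u => q u - muq P / 2 * sqnorm u) (fun u => grad q u - muq P *: u)
    xs ys (st_x s) (st_y s) (st_xf s) (st_yf s).

Lemma potential_decay k :
  potential (iterate k) <= (1 - alpha P / 4) ^+ k * potential (iterate 0).
Proof.
have [a0 a1 mex mey [Lex Ley _]] := step_sizes mup0 muq0 mLp mLq.
elim: k => [|k IH]; first by rewrite expr0 mul1r.
rewrite iterateS exprS -mulrA.
apply: le_trans (_ : (1 - alpha P / 4) * potential (iterate k) <= _); last first.
  by rewrite ler_wpM2l //; lra.
move: (iterate k) => s.
have [xh [yh [acc ->]]] := iteration_prog_spec s.
apply: (outer_step (shifted_lower pmu)
  (fun u v => shifted_upper pL pmu u v (ltW mup0)) (shifted_lower qmu)
  (fun u v => shifted_upper qL qmu u v (ltW muq0)) a0 a1 ex0 ey0 mex mey Lex Ley) acc.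
  by rewrite addrA subrK.
by rewrite addrA subrK.
Qed.

(** The larger step size turns the weighted distance into the plain one; adding 1 keeps the constant
    positive even when the run starts at the saddle point. *)
Definition initial_constant : R :=
  Num.max (eta_x P) (eta_y P) * potential (iterate 0) + 1.

Lemma potential_ge0 s : 0 <= potential s.
Proof.
exact: outer_potential_ge0 (shifted_lower pmu) (shifted_lower qmu)
  (alpha_gt0 mup0 muq0 mLp mLq) ex0 ey0 _ _ _ _ _ _.
Qed.

Lemma initial_constant_gt0 : 0 < initial_constant.
Proof.
by rewrite ltr_wpDl // mulr_ge0 ?potential_ge0 // le_max (ltW ex0).
Qed.

Lemma sqdist_decay k :
  sqnorm (st_x (iterate k) - xs) + sqnorm (st_y (iterate k) - ys)
  <= (1 - alpha P / 4) ^+ k * initial_constant.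
Proof.
have a0 := alpha_gt0 mup0 muq0 mLp mLq; have a1 := alpha_le1 mup0 muq0 mLp mLq.
set m := Num.max (eta_x P) (eta_y P).
have m0 : 0 <= m by rewrite le_max (ltW ex0).
have r0 : 0 <= (1 - alpha P / 4) ^+ k by rewrite exprn_ge0; lra.
have h1 : sqnorm (st_x (iterate k) - xs) <= m * ((eta_x P)^-1 * sqnorm (st_x (iterate k) - xs)).
  by rewrite mulrA ler_peMl ?sqnorm_ge0 // ler_pdivlMr // mul1r le_max lexx.
have h2 : sqnorm (st_y (iterate k) - ys) <= m * ((eta_y P)^-1 * sqnorm (st_y (iterate k) - ys)).
  by rewrite mulrA ler_peMl ?sqnorm_ge0 // ler_pdivlMr // mul1r le_max lexx orbT.
apply: le_trans (lerD h1 h2) _; rewrite -mulrDr.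
have h3 := le_outer_potential (shifted_lower pmu) (shifted_lower qmu) a0 ex0 ey0
  xs ys (st_x (iterate k)) (st_y (iterate k)) (st_xf (iterate k)) (st_yf (iterate k)).
apply: le_trans (ler_wpM2l m0 h3) _.
apply: le_trans (ler_wpM2l m0 (potential_decay k)) _.
by rewrite mulrCA ler_wpM2l // /initial_constant lerDl.
Qed.

(** The count follows from [1 - alpha P / 4 <= expR (- (alpha P / 4))]. It depends on the saddle
    point, which is harmless for a number whose existence alone is claimed. *)
Definition outer_steps (eps : R) : nat :=
  (Num.truncn (4 / alpha P * log_factor (initial_constant / eps))).+1.

Lemma outer_steps_sqdist eps : 0 < eps ->
  sqnorm (st_x (iterate (outer_steps eps)) - xs)
  + sqnorm (st_y (iterate (outer_steps eps)) - ys) <= eps.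
Proof.
move=> eps0; have a0 := alpha_gt0 mup0 muq0 mLp mLq.
have a1 := alpha_le1 mup0 muq0 mLp mLq; have C0 := initial_constant_gt0.
apply: le_trans (sqdist_decay _) _; set K := outer_steps eps.
have hK : log_factor (initial_constant / eps) <= K%:R * (alpha P / 4).
  rewrite -ler_pdivrMr ?divr_gt0 // invf_div mulrC; apply: ltW.
  exact: truncnS_gt.
have h : (1 - alpha P / 4) ^+ K <= (expR (log_factor (initial_constant / eps)))^-1.
  apply: (@le_trans _ _ (expR (- (alpha P / 4)) ^+ K)).
    rewrite lerXn2r ?nnegrE ?expR_ge0 ?(le_trans _ (expR_ge1Dx _)) //; lra.
  by rewrite -expRN -expRM_natl ler_expR mulrN lerN2.
apply: le_trans (ler_wpM2r (ltW C0) h) _.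
rewrite ler_pdivrMl ?expR_gt0 // -ler_pdivrMr //.
exact: expR_log_factor_ge.
Qed.

(** Both the logarithmic factor and the inverse of [alpha P] are at least 1, so the rounding adds at
    most one more unit to the coefficient 4. *)
Lemma outer_steps_le eps :
  (outer_steps eps)%:R <= 5 / alpha P * log_factor (initial_constant / eps).
Proof.
have a0 := alpha_gt0 mup0 muq0 mLp mLq; have a1 := alpha_le1 mup0 muq0 mLp mLq.
have l1 := log_factor_ge1 (initial_constant / eps).
have ia : 1 <= (alpha P)^-1 by rewrite invf_ge1.
rewrite /outer_steps -addn1 natrD; move: (log_factor _) l1 => l l1.
have X : 1 <= (alpha P)^-1 * l by rewrite mulr_ege1.
have : (Num.truncn (4 / alpha P * l))%:R <= 4 / alpha P * l.
  by rewrite truncn_le -mulrA; lra.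
rewrite -!mulrA; move: (_ * l) X => *; lra.
Qed.

(** Two gradients per outer iteration give the constant 10; 470 is shared with the count of
    products. *)
Lemma grad_complexity eps :
  (grad_calls p q B (alg (outer_steps eps)))%:R
  <= 470 * (grad_rate P * log_factor (initial_constant / eps)).
Proof.
rewrite grad_calls_algorithm natrM grad_rateE //.
have := outer_steps_le eps; rewrite -mulrA.
have : 0 <= (alpha P)^-1 * log_factor (initial_constant / eps).
  rewrite mulr_ge0 ?invr_ge0 ?(ltW (alpha_gt0 _ _ _ _)) //.
  exact: le_trans (log_factor_ge1 _).
move: (_^-1 * _) => ? ?; lra.
Qed.

Lemma product_complexity eps :
  (product_calls p q B (alg (outer_steps eps)))%:R
  <= 470 * (product_rate P * log_factor (initial_constant / eps)).
Proof.
have a0 := alpha_gt0 mup0 muq0 mLp mLq.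
have th0 := hess_rate_gt0 mup0 muq0 ex0 ey0 lmin0 lminmax.
rewrite product_calls_algorithm natrM.
apply: le_trans (ler_pM _ _ (outer_steps_le eps)
  (inner_steps_le mup0 muq0 mLp mLq lmin0 lminmax)) _ => //.
have l1 := log_factor_ge1 (initial_constant / eps).
rewrite /product_rate; set t := Num.sqrt _ / _; have l2 := log_factor_ge1 t.
move: (log_factor t) (log_factor (_ / eps)) l2 l1 => l' l l1' l1.
(* The outer count contributes 5 and the inner one 47; the factor 2 of [rate_B_ge] then leads to
   470. *)
rewrite (_ : _ * (47 * _) = 235 * ((alpha P * hess_rate P)^-1 * (l' * l))); last first.
  by field; rewrite !lt0r_neq0.
have ll : 0 <= l' * l by rewrite mulr_ge0; lra.
have := ler_wpM2r ll (rate_B_ge mup0 muq0 mLp mLq lmin0 lminmax).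
rewrite -(mulrA (rate_B P)) -(mulrA 2).
by move: (_^-1 * _) (rate_B P * _) => *; lra.
Qed.

End Correctness.

(** If either dimension is 0, then [B *m B^T] vanishes. *)
Lemma lambda_max_gt0_dims (R : realType) dx dy (B : 'M[R]_(dx, dy)) :
  0 < lambda_max (B *m B^T) -> (0 < dx)%N /\ (0 < dy)%N.
Proof.
move=> /lambda_max_neq0; case: dx B => [|dx] B; first by rewrite flatmx0 eqxx.
by case: dy B => [|dy] B //; rewrite [B]thinmx0 mul0mx eqxx.
Qed.

Theorem theorem4 (R : realType) :
  exists (c : R) (solve : inner_solver R),
    0 < c /\
    (forall (dx dy : nat) (P : params R)
            (xk : 'cV[R]_dx) (yk : 'cV[R]_dy) (gx : 'cV[R]_dx) (gy : 'cV[R]_dy),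
       products_only (solve dx dy P xk yk gx gy)) /\
    forall (dx dy : nat) (p : 'cV[R]_dx -> R) (q : 'cV[R]_dy -> R)
           (B : 'M[R]_(dx, dy)) (Lp Lq mup muq : R),
      0 < mup -> 0 < muq ->
      smooth Lp p -> strongly_convex mup p ->
      smooth Lq q -> strongly_convex muq q ->
      0 < lambda_max (B *m B^T) -> 0 <= lambda_min (B *m B^T) ->
      let P := Params Lp Lq mup muq
                 (lambda_max (B *m B^T)) (lambda_min (B *m B^T)) in
      forall (x0 : 'cV[R]_dx) (y0 : 'cV[R]_dy),
      let alg := algorithm solve P x0 y0 in
      let iterate (k : nat) := result p q B (alg k) in
      exists C : R, 0 < C /\
        forall eps : R, 0 < eps ->
          exists K : nat,
            (forall k : nat, (k < K)%N ->
               iteration p q B P (iterate k) (iterate k.+1)) /\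
            eps_solution p q B eps (st_x (iterate K)) (st_y (iterate K)) /\
            (grad_calls p q B (alg K))%:R
              <= c * (grad_rate P * log_factor (C / eps)) /\
            (product_calls p q B (alg K))%:R
              <= c * (product_rate P * log_factor (C / eps)).
Proof.
exists 470, (fun dx dy => @accel_solve R dx dy); split=> //; split.
  by move=> *; exact: products_only_accel_solve.
move=> dx dy p q B Lp Lq mup muq mup0 muq0 pL pmu qL qmu lmax0 lmin0 P x0 y0 alg iterate.
have [dx0 dy0] := lambda_max_gt0_dims lmax0.
have BT : (B *m B^T)^T = B *m B^T by rewrite trmx_mul trmxK.
have BP := lambda_rayleigh dx0 BT.
(* The two Rayleigh bounds are compared on one basis vector. *)
have lminmax : lmin P <= lmax P.
  have v0 : 0 < sqnorm (delta_mx (Ordinal dx0) ord0 : 'cV[R]_dx).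
    by rewrite /sqnorm dot_delta mxE !eqxx.
  by rewrite -(ler_pM2r v0); have /andP [h1 h2] := BP (delta_mx (Ordinal dx0) ord0);
    exact: le_trans h1 h2.
have mLp := strong_convexity_le_smoothness pL pmu dx0.
have mLq := strong_convexity_le_smoothness qL qmu dy0.
have [xs [ys [px qy]]] := stationary_exists B mup0 muq0 pL pmu qL qmu.
exists (initial_constant P p q B x0 y0 xs ys); split.
  exact: (@initial_constant_gt0 _ _ _ P).
move=> eps eps0; exists (outer_steps P p q B x0 y0 xs ys eps); split; [|split; [|split]].
- move=> k _; rewrite /iterate /alg iterateS.
  exact: (@iteration_prog_iteration _ _ _ P).
- exists xs, ys; split; first exact: (stationary_saddle_point mup0 muq0 pmu qmu).
  exact: (@outer_steps_sqdist _ _ _ P).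
- exact: (@grad_complexity _ _ _ P).
- exact: (@product_complexity _ _ _ P).
Qed.
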